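(* There is a constant $E_0<\infty$ such that for all $\epsilon\in(0,1]$, if $(\theta^\epsilon,a^\epsilon,\delta^\epsilon)$ is a minimizer of $\mathcal{F}^\epsilon[\theta;a,\delta]$ over all $a\in[0,1]$, $\delta\in\mathbb{R}$ and all $\theta$ admissible for $(\epsilon,a,\delta)$, then $$\mathcal{F}^\epsilon[\theta^\epsilon;a^\epsilon,\delta^\epsilon]\le E_0 .$$
   Context: For $\epsilon\in(0,1]$ put $l=\pi/\epsilon$ and let $\mathcal{S}^\epsilon=\{(x,y): 0\le x<l,\ y\ge 0\}$, regarded as a half-cylinder, $l$-periodic in $x$. For $a\in[0,1]$ and $\delta\in\mathbb{R}$, a real-valued function $\theta$ is called admissible for $(\epsilon,a,\delta)$ if it satisfies the boundary conditions (understood in the sense of traces) (i) $\theta(x,0)=0$ for $0\le x<al$; (ii) $\theta_y(x,0)=0$ for $al\le x<l$; (iii) $\theta(x,y)-\epsilon x$ is periodic in $x$ with period $l$ for each $y\ge 0$; (iv) $\theta(x,y)-\left[\epsilon x+\sqrt{1-\epsilon^2}\,y+\delta\right]\in H^2(\mathcal{S}^\epsilon)$, where $H^2$ is taken on the half-cylinder (i.e. the $l$-periodic extension in $x$ is locally $H^2$ on the closed upper half-plane, and it is $H^2$ over one period). For admissible $\theta$ the energy is $$\mathcal{F}^\epsilon[\theta;a,\delta]=\iint_{\mathcal{S}^\epsilon}\left\{[\Delta\theta]^2+(1-|\nabla\theta|^2)^2\right\}dx\,dy .$$ A triple $(\theta^\epsilon,a^\epsilon,\delta^\epsilon)$ denotes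 a minimizer of $\mathcal{F}^\epsilon$ jointly over all $a\in[0,1]$, $\delta\in\mathbb{R}$ and admissible $\theta$; such a minimizer exists for each $\epsilon$ by the direct method. *)

(* Defs.v *)
From HB Require Import structures.
From mathcomp Require Import all_boot all_order all_algebra.
From mathcomp Require Import all_classical all_reals all_analysis.

Set Implicit Arguments.
Unset Strict Implicit.
Unset Printing Implicit Defensive.

Import Order.TTheory GRing.Theory Num.Theory.
Import numFieldNormedType.Exports.

Local Open Scope classical_set_scope.
Local Open Scope ring_scope.

(* Functions of (x, y) are total functions R * R -> R; only their values on the
   closed upper half-plane y >= 0 ever matter. *)

Section Sobolev.
Variable R : realType.
Implicit Types (u v w f phi : R * R -> R) (d z : R * R) (A : set (R * R)).

Definition mu2 := (@lebesgue_measure R \x @lebesgue_measure R)%E.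

Definition dirx : R * R := (1, 0).
Definition diry : R * R := (0, 1).

Definition upper : set (R * R) := [set z | 0 < z.2].
Definition uppercl : set (R * R) := [set z | 0 <= z.2].
Definition box (r : R) : set (R * R) := `[- r, r]%classic `*` `[0, r]%classic.

Fixpoint Ck (k : nat) f : Prop :=
  match k with
  | 0 => continuous f
  | k'.+1 => [/\ continuous f,
                 forall z, derivable f z dirx /\ derivable f z diry,
                 Ck k' (fun z => 'D_dirx f z) &
                 Ck k' (fun z => 'D_diry f z)]
  end.

(* C_c^oo of the open upper half-plane, extended by zero. *)
Definition test_function phi : Prop :=
  (forall k, Ck k phi) /\
  exists2 K : set (R * R), compact K /\ K `<=` upper
                         & forall z, ~ K z -> phi z = 0.

(* L^1_loc of the open upper half-plane. *)
Definition L1loc f : Prop :=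
  forall a b c d : R, 0 < c ->
    mu2.-integrable (`[a, b]%classic `*` `[c, d]%classic) (EFin \o f).

Definition weak_deriv d u v : Prop :=
  [/\ L1loc u, L1loc v &
      forall phi, test_function phi ->
        \int[mu2]_(z in upper) (u z * 'D_d phi z) =
        - \int[mu2]_(z in upper) (v z * phi z)].

Definition L2on A f : Prop :=
  measurable_fun A f /\ (\int[mu2]_(z in A) ((f z) ^+ 2)%:E < +oo)%E.

(* L^2_loc up to the boundary y = 0. *)
Definition L2loc f : Prop := forall r : R, 0 < r -> L2on (box r) f.

(* u is H^1_loc of the closed upper half-plane with weak gradient (ux, uy). *)
Definition H1loc u ux uy : Prop :=
  [/\ weak_deriv dirx u ux, weak_deriv diry u uy, L2loc u, L2loc ux & L2loc uy].

Definition L2loc_cvg (un : nat -> R * R -> R) u : Prop :=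
  forall r : R, 0 < r ->
    (\int[mu2]_(z in box r) ((un n z - u z) ^+ 2)%:E)%E @[n --> \oo] --> 0%E.

(* The graph of the trace operator on y = 0: the closure, with respect to
   H^1_loc convergence of the functions and L^2_loc convergence of the boundary
   values, of the restriction map u |-> u(., 0) on the functions of H^1_loc that
   are continuous up to the boundary. *)
Definition trace u (g : R -> R) : Prop :=
  measurable_fun setT g /\
  exists ux uy, H1loc u ux uy /\
  exists un unx uny : nat -> R * R -> R,
    [/\ forall n, {within uppercl, continuous (un n)} /\
                  H1loc (un n) (unx n) (uny n),
        L2loc_cvg un u, L2loc_cvg unx ux, L2loc_cvg uny uy &
        forall r : R, 0 < r ->
          (\int[lebesgue_measure]_(x in `[(- r)%R, r%R]%classic)
             ((un n (x, 0%R) - g x) ^+ 2)%:E)%E @[n --> \oo] --> 0%E].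

End Sobolev.

Section PhaseEnergy.
Variable R : realType.
Implicit Types (theta w : R * R -> R) (eps a delta : R).

Definition period eps : R := pi / eps.

Definition cyl eps : set (R * R) :=
  `[0, period eps[%classic `*` `[0, +oo[%classic.

Definition xperiodic eps w : Prop :=
  forall x y : R, 0 <= y -> w (x + period eps, y) = w (x, y).

Definition L2cyl eps f : Prop := L2loc f /\ L2on (cyl eps) f.

Definition H2cyl eps w : Prop :=
  xperiodic eps w /\
  exists wx wy wxx wxy wyy : R * R -> R,
    [/\ weak_deriv (dirx R) w wx, weak_deriv (diry R) w wy,
        weak_deriv (dirx R) wx wxx, weak_deriv (diry R) wx wxy &
        weak_deriv (diry R) wy wyy] /\
    [/\ L2cyl eps w, L2cyl eps wx, L2cyl eps wy &
        [/\ L2cyl eps wxx, L2cyl eps wxy & L2cyl eps wyy]].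

Definition admissible eps a delta theta : Prop :=
  [/\ exists2 g, trace theta g &
        {ae lebesgue_measure, forall x, 0 <= x < a * period eps -> g x = 0},
      exists thetay g, [/\ weak_deriv (diry R) theta thetay, trace thetay g &
        {ae lebesgue_measure,
          forall x, a * period eps <= x < period eps -> g x = 0}],
      xperiodic eps (fun z => theta z - eps * z.1) &
      H2cyl eps (fun z => theta z -
        (eps * z.1 + Num.sqrt (1 - eps ^+ 2) * z.2 + delta))].

(* Weak derivatives are unique only up to null sets, so the set below has at
   most one element; its infimum is that element, or +oo when theta lacks the
   required weak derivatives. The energy depends on (a, delta) only through
   the admissibility of theta. *)
Definition energy eps theta : \bar R :=
  ereal_inf [set E | exists tx ty txx tyy : R * R -> R,
    [/\ weak_deriv (dirx R) theta tx, weak_deriv (diry R) theta ty,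
        weak_deriv (dirx R) tx txx, weak_deriv (diry R) ty tyy &
        E = (\int[@mu2 R]_(z in cyl eps)
              ((txx z + tyy z) ^+ 2 +
               (1 - (tx z ^+ 2 + ty z ^+ 2)) ^+ 2)%:E)%E]].

Definition minimizer eps theta a delta : Prop :=
  [/\ 0 <= a <= 1, admissible eps a delta theta &
      forall (theta' : R * R -> R) (a' delta' : R),
        0 <= a' <= 1 -> admissible eps a' delta' theta' ->
        (energy eps theta <= energy eps theta')%E].

End PhaseEnergy.

(* Main.v *)
From HB Require Import structures.
Require Import Defs.
From mathcomp Require Import all_boot all_order all_algebra.
From mathcomp Require Import all_classical all_reals all_analysis.
From mathcomp Require Import measurable_realfun.
From mathcomp Require Import ring lra.
Set Implicit Arguments.
Unset Strict Implicit.
Unset Printing Implicit Defensive.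

Import Order.TTheory GRing.Theory Num.Theory.
Import numFieldNormedType.Exports.

Local Open Scope classical_set_scope.
Local Open Scope ring_scope.

(** Since a minimizer has at most the energy of any admissible phase, it is
    enough to exhibit, for each [eps], an admissible phase whose energy is
    bounded independently of [eps].

    Write [l = pi / eps].  The competitor has [a l = l - 2] and [delta = 0].
    Its trace vanishes on [0 <= x <= l - 2], while a phase gains [pi] over a
    period, so a jump of [pi] takes place in the free interval of length 2; it
    then has to spread out until it becomes the uniform slope [eps].  The
    competitor lets the jump widen like a diffusion profile.  With
    [rho y = (1 + y^2)^(-1/4)] and [S] a smooth step from 0 to 1, put on
    [0 <= x < l]
      [phi = pi S (1 + (x - l + 1/4) (eps + rho y))]
    and
      [Theta = y + phi + tau (eps x - k y - phi) - B],
    where [k = 1 - sqrt (1 - eps^2)], where [tau = S (eps^2 y)] switches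
    to the exact linear phase, reached at height [1 / eps^2], and where [B]
    vanishes for [y = 0], has vertical derivative 1 on the free interval, and is
    supported within bounded distance of it modulo the period; the term [B]
    enforces the Neumann condition there.  For [x] near 0 the same formula
    gives [Theta (x + l, y) = Theta (x, y) + pi], so [Theta] extends to a [C^2]
    function of the plane, whose classical derivatives are its weak
    derivatives ([weak_dirx], [weak_diry]); see [admissible_phase].

    For the energy, [P = Theta - y] obeys parabolic bounds at a scale [t]:
    [|P| <= C], [|P_x| <= C t] and [|P_y|, |P_xx|, |P_yy| <= C t^2]
    ([scaled_pert]), with [t = rho y] where the profile varies or [B] acts (a
    set of width [O(1 / rho y)]) and [t = eps] elsewhere.  The energy density
    is then [O(t^4)] ([density_bound]), because in
    [1 - |grad Theta|^2 = - (2 P_y + P_y^2 + P_x^2)] every term is [O(t^2)].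
    At height [y <= 1 / eps^2], where [eps <= 2 rho y], the integral over a
    period is [O(eps^4 l + rho y ^ 4 / rho y) = O(rho y ^ 3)]
    ([dens_section_le]); above that height the density vanishes.  As
    [rho ^ 3] decays like [y^(-3/2)], its integral over [y >= 0] is finite
    ([integral_rho3]). *)

(** * Measurability of continuous functions of two variables *)

Section Plane.
Variable R : realType.

(** An open set of the plane is a countable union of squares with rational
    centre and radius. *)
Lemma open_measurable_prod (U : set (R * R)) : open U -> measurable U.
Proof.
move=> oU.
pose B (p q r : rat) : set (R * R) :=
  `]ratr p - ratr r, ratr p + ratr r[%classic `*`
  `]ratr q - ratr r, ratr q + ratr r[%classic.
rewrite (_ : U = \bigcup_p \bigcup_q \bigcup_r
   (if `[< B p q r `<=` U >] then B p q r else set0)); last first.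
  apply/seteqP; split => [[x y] Uz|z [p _ [q _ [r _]]]]; last first.
    by case: asboolP => // + Bz; apply.
  have /nbhs_ballP[e /= e0 eU] : nbhs (x, y) U by exact: open_nbhs_nbhs.
  (* a radius below [e / 2] and a centre within this radius of [(x, y)] *)
  have [r] := @rat_in_itvoo R 0 (e / 2) ltac:(lra).
  rewrite in_itv /= => /andP[r0 re].
  have [p] := @rat_in_itvoo R (x - ratr r) (x + ratr r) ltac:(lra).
  rewrite in_itv /= => /andP[p1 p2].
  have [q] := @rat_in_itvoo R (y - ratr r) (y + ratr r) ltac:(lra).
  rewrite in_itv /= => /andP[q1 q2].
  exists p => //; exists q => //; exists r => //; rewrite ifT; last first.
    apply/asboolP => -[x' y'] [/=]; rewrite !in_itv /= => /andP[? ?] /andP[? ?].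
    apply: eU; split => /=; rewrite /ball /= ltr_norml; lra.
  by split => /=; rewrite in_itv /=; apply/andP; split; lra.
apply: bigcupT_measurable_rat => p.
apply: bigcupT_measurable_rat => q.
apply: bigcupT_measurable_rat => r.
by case: asboolP => // _; apply: measurableX.
Qed.

Lemma continuous_measurable_prod (f : R * R -> R) (D : set (R * R)) :
  measurable D -> continuous f -> measurable_fun D f.
Proof.
move=> mD /continuousP cf; apply: (measurability _ (RGenOpens.measurableE R)).
move=> _ [_ [a [b ->] <-]]; apply: measurableI => //.
by apply: open_measurable_prod; apply: cf; exact: interval_open.
Qed.

(** The closed rectangle [a <= x <= b], [c <= y <= d]. *)
Definition rect (a b c d : R) : set (R * R) := `[a, b]%classic `*` `[c, d]%classic.

Lemma measurable_rect a b c d : measurable (rect a b c d).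
Proof. exact: measurableX. Qed.

Lemma mu2_rect_fin a b c d : (@mu2 R (rect a b c d) < +oo)%E.
Proof.
rewrite /mu2 product_measure1E//= !lebesgue_measure_itv.
by case: ifP => _; case: ifP => _; rewrite ?mul0e ?mule0 -?EFinD -?EFinM ?ltry.
Qed.

Lemma compact_rect a b c d : compact (rect a b c d).
Proof. by apply: compact_setX; exact: segment_compact. Qed.

Lemma continuous_integrable_rect (f : R * R -> R) a b c d :
  continuous f -> (@mu2 R).-integrable (rect a b c d) (EFin \o f).
Proof.
move=> cf; apply: measurable_bounded_integrable.
- exact: measurable_rect.
- exact: mu2_rect_fin.
- by apply: continuous_measurable_prod => //; exact: measurable_rect.
- have /compact_bounded[M [_ mrt]] : compact (f @` rect a b c d).
    by apply: continuous_compact; [exact: continuous_subspaceT|exact: compact_rect].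
  by exists M; split; rewrite ?num_real // => ? ? ? ?; apply: mrt => //; exact: imageP.
Qed.

End Plane.

(** * Partial derivatives and integrals of compactly supported derivatives *)

Section PartialDerivatives.
Variable R : realType.
Implicit Types (f g phi W w : R * R -> R).

(** A partial derivative is the derivative of the restriction to a line. *)
Lemma is_derive_dirx f x y df :
  is_derive (x, y) (dirx R) f df <-> is_derive x 1 (fun t => f (t, y)) df.
Proof.
have E : (fun h => h^-1 *: ((f \o shift (x, y)) (h *: dirx R) - f (x, y))) =
   (fun h => h^-1 *: (((fun t => f (t, y)) \o shift x) (h *: 1) - f (x, y))).
  apply/funext => h; congr (_ *: (f _ - _)).
  by rewrite /shift /= /dirx; congr pair; rewrite /= ?scaler0 ?add0r.
by split => -[dfx <-]; split; move: dfx; rewrite /derivable /derive E.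
Qed.

Lemma is_derive_diry f x y df :
  is_derive (x, y) (diry R) f df <-> is_derive y 1 (fun t => f (x, t)) df.
Proof.
have E : (fun h => h^-1 *: ((f \o shift (x, y)) (h *: diry R) - f (x, y))) =
   (fun h => h^-1 *: (((fun t => f (x, t)) \o shift y) (h *: 1) - f (x, y))).
  apply/funext => h; congr (_ *: (f _ - _)).
  by rewrite /shift /= /diry; congr pair; rewrite /= ?scaler0 ?add0r.
by split => -[dfx <-]; split; move: dfx; rewrite /derivable /derive E.
Qed.

Lemma continuous_slicex f y : continuous f -> continuous (fun t => f (t, y)).
Proof.
move=> cf x; apply: (@continuous_comp _ _ _ (fun t => (t, y)) f); last exact: cf.
by apply: (@cvg_pair _ _ _ _ (nbhs x) (nbhs y)) => /=; [exact: cvg_id|exact: cvg_cst].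
Qed.

Lemma continuous_slicey f x : continuous f -> continuous (fun t => f (x, t)).
Proof.
move=> cf y; apply: (@continuous_comp _ _ _ (fun t => (x, t)) f); last exact: cf.
by apply: (@cvg_pair _ _ _ _ (nbhs x) (nbhs y)) => /=; [exact: cvg_cst|exact: cvg_id].
Qed.

Lemma integral_FTC (g G : R -> R) (a b : R) : a < b -> continuous g ->
  (forall t : R, is_derive t 1 G (g t)) ->
  (\int[lebesgue_measure]_(t in `[a, b]) (g t)%:E = (G b)%:E - (G a)%:E)%E.
Proof.
move=> ab cg dG; apply: continuous_FTC2 => //.
- exact: continuous_subspaceT.
- have cG t : {for t, continuous G}.
    by apply: differentiable_continuous; apply/derivable1_diffP; case: (dG t).
  split => [t _||]; first by case: (dG t).
  + exact/cvg_at_right_filter/cG.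
  + exact/cvg_at_left_filter/cG.
- by move=> t _; rewrite derive1E; case: (dG t).
Qed.

Lemma integral_derive_eq0 (g G : R -> R) (r : R) : 0 < r -> continuous g ->
  (forall t : R, is_derive t 1 G (g t)) ->
  (forall t, r <= `|t| -> g t = 0) -> (forall t, r <= `|t| -> G t = 0) ->
  (\int[lebesgue_measure]_t (g t)%:E = 0)%E.
Proof.
move=> r0 cg dG g0 G0.
have -> : (fun t => (g t)%:E) = ((fun t => (g t)%:E) \_ `[(- r)%R, r])%E.
  apply/funext => t; rewrite patchE; case: ifPn => //.
  rewrite notin_setE /= in_itv /= => /negP h; rewrite g0//.
  by rewrite leNgt; apply: contra h; rewrite ltr_norml => /andP[/ltW -> /ltW ->].
rewrite -integral_mkcond (integral_FTC (G := G))//; last lra.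
by rewrite !G0 ?subee// ?normrN ger0_norm// ltW.
Qed.

Lemma compact_box (K : set (R * R)) : compact K ->
  exists2 r, 0 < r & forall z, K z -> `|z.1| < r /\ `|z.2| < r.
Proof.
move=> /compact_bounded[M [_ KM]]; exists (`|M| + 1); first by rewrite ltr_wpDl.
move=> z /(KM (`|M| + 1/2)) h.
have {h} : `|z| <= `|M| + 1/2 by apply: h; have := ler_norm M; lra.
rewrite prod_normE ge_max => /andP[? ?]; split; lra.
Qed.

Section support.
Variables (K : set (R * R)) (f : R * R -> R).
Hypotheses (cK : compact K) (cf : continuous f) (f0 : forall z, ~ K z -> f z = 0).

Lemma integrable_support : (@mu2 R).-integrable setT (EFin \o f).
Proof.
have [r r0 Kr] := compact_box cK.
have -> : EFin \o f = ((EFin \o f) \_ (rect (- r)%R r (- r)%R r))%E.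
  apply/funext => z; rewrite patchE; case: ifPn => //=.
  rewrite notin_setE => h; rewrite f0// => /Kr [].
  rewrite !ltr_norml => /andP[/ltW ? /ltW ?] /andP[/ltW ? /ltW ?]; apply: h.
  by split => /=; rewrite in_itv /=; apply/andP.
apply: (integrable_mkcond _ _).1; first exact: measurable_rect.
exact: continuous_integrable_rect.
Qed.

(** For a function vanishing off [K], the domain of integration is irrelevant
    as soon as it contains [K]. *)
Lemma integral_support (A : set (R * R)) : K `<=` A ->
  (\int[@mu2 R]_(z in A) (f z)%:E = \int[@mu2 R]_z (f z)%:E)%E.
Proof.
move=> KA; rewrite integral_mkcond; apply: eq_integral => z _.
rewrite patchE; case: ifPn => // zA; rewrite f0// => /KA.
by move: zA; rewrite notin_setE.
Qed.

End support.

(** By Fubini and the fundamental theorem of calculus on each line, a partial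
    derivative of a compactly supported function has integral zero. *)
Lemma integral_dirx_eq0 K W w : compact K -> continuous w ->
  (forall z, is_derive z (dirx R) W (w z)) ->
  (forall z, ~ K z -> W z = 0) -> (forall z, ~ K z -> w z = 0) ->
  (\int[@mu2 R]_z (w z)%:E = 0)%E.
Proof.
move=> cK cw dW W0 w0.
have [r r0 Kr] := compact_box cK.
rewrite -(integral21_prod_meas1 (integrable_support cK cw w0)).
rewrite integral0_eq// => y _; rewrite /fubini_G.
apply: (@integral_derive_eq0 (fun t => w (t, y)) (fun t => W (t, y)) r) => //.
- exact: continuous_slicex.
- by move=> t; exact/is_derive_dirx.
- by move=> t rt; apply: w0 => /Kr[/=]; lra.
- by move=> t rt; apply: W0 => /Kr[/=]; lra.
Qed.

Lemma integral_diry_eq0 K W w : compact K -> continuous w ->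
  (forall z, is_derive z (diry R) W (w z)) ->
  (forall z, ~ K z -> W z = 0) -> (forall z, ~ K z -> w z = 0) ->
  (\int[@mu2 R]_z (w z)%:E = 0)%E.
Proof.
move=> cK cw dW W0 w0.
have [r r0 Kr] := compact_box cK.
rewrite -(integral12_prod_meas1 (integrable_support cK cw w0)).
rewrite integral0_eq// => x _; rewrite /fubini_F.
apply: (@integral_derive_eq0 (fun t => w (x, t)) (fun t => W (x, t)) r) => //.
- exact: continuous_slicey.
- by move=> t; exact/is_derive_diry.
- by move=> t rt; apply: w0 => /Kr[/=]; lra.
- by move=> t rt; apply: W0 => /Kr[/=]; lra.
Qed.

End PartialDerivatives.

(** * Classical derivatives are weak derivatives; traces of continuous functions *)

Section WeakDerivatives.
Variable R : realType.
Implicit Types (f g u v phi W w : R * R -> R).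

Lemma derive_off_support K phi z d : compact K ->
  (forall z, ~ K z -> phi z = 0) -> ~ K z -> 'D_d phi z = 0.
Proof.
move=> cK phi0 Kz.
have : is_derive z d phi 0.
  apply: (@near_eq_is_derive _ _ _ (cst 0)).
  have : open (~` K).
    by apply: closed_openC; apply: compact_closed => //; exact: norm_hausdorff.
  rewrite openE => /(_ z Kz); apply: filterS => t /phi0 ->//.
by case.
Qed.

(** Integration by parts, for a direction in which derivatives of compactly
    supported functions have integral zero and test functions are continuously
    differentiable. *)
Lemma weak_deriv_by_parts d u v :
  (forall K W w, compact K -> continuous w ->
    (forall z, is_derive z d W (w z)) ->
    (forall z, ~ K z -> W z = 0) -> (forall z, ~ K z -> w z = 0) ->
    (\int[@mu2 R]_z (w z)%:E = 0)%E) ->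
  (forall phi, test_function phi ->
     (forall z, derivable phi z d) /\ continuous ('D_d phi)) ->
  continuous u -> continuous v ->
  (forall z, is_derive z d u (v z)) -> weak_deriv d u v.
Proof.
move=> ibp0 tf cu cv duv; split.
- by move=> a b c e _; exact: continuous_integrable_rect.
- by move=> a b c e _; exact: continuous_integrable_rect.
move=> phi tphi; have [dphi cdphi] := tf _ tphi.
have [/(_ 0%N) cphi [K [cK KU] phi0]] := tphi.
rewrite /= in cphi.
have dphi0 z : ~ K z -> 'D_d phi z = 0 by exact: derive_off_support.
pose f1 := u \* 'D_d phi; pose f2 := v \* phi.
have cf1 : continuous f1 by move=> z; apply: cvgM; [exact: cu|exact: cdphi].
have cf2 : continuous f2 by move=> z; apply: cvgM; [exact: cv|exact: cphi].
have f10 z : ~ K z -> f1 z = 0 by move=> /dphi0 h; rewrite /f1 /= h mulr0.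
have f20 z : ~ K z -> f2 z = 0 by move=> /phi0 h; rewrite /f2 /= h mulr0.
rewrite /Rintegral.
have i1 := integral_support f10 KU; have i2 := integral_support f20 KU.
rewrite /f1 /= in i1; rewrite /f2 /= in i2; rewrite i1 i2 {i1 i2}.
have I1 := integrable_support cK cf1 f10.
have I2 := integrable_support cK cf2 f20.
apply/eqP; rewrite -addr_eq0 -fineD; last 2 first.
- exact: integrable_fin_num I1.
- exact: integrable_fin_num I2.
rewrite -integralD//.
have dW z : is_derive z d (u * phi) ((f1 \+ f2) z).
  rewrite (_ : (f1 \+ f2) z = u z *: 'D_d phi z + phi z *: v z).
    by apply: is_deriveM; exact: DeriveDef.
  by rewrite /f1 /f2 /= /GRing.scale /= (mulrC (phi z)).
have H0 : (\int[@mu2 R]_z ((f1 z)%:E + (f2 z)%:E) = 0)%E.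
  apply: (ibp0 K (u * phi) (f1 \+ f2)) => //.
  - by move=> z; apply: cvgD; [exact: cf1|exact: cf2].
  - by move=> z /phi0 h; rewrite fctE h mulr0.
  - by move=> z Kz; rewrite /= f10// f20// addr0.
by rewrite H0.
Qed.

Lemma weak_dirx u v : continuous u -> continuous v ->
  (forall z, is_derive z (dirx R) u (v z)) -> weak_deriv (dirx R) u v.
Proof.
apply: weak_deriv_by_parts; first exact: integral_dirx_eq0.
by move=> phi [/(_ 1%N)[_ h cx _] _]; split => // z; case: (h z).
Qed.

Lemma weak_diry u v : continuous u -> continuous v ->
  (forall z, is_derive z (diry R) u (v z)) -> weak_deriv (diry R) u v.
Proof.
apply: weak_deriv_by_parts; first exact: integral_diry_eq0.
by move=> phi [/(_ 1%N)[_ h _ cy] _]; split => // z; case: (h z).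
Qed.

Lemma continuous_sqr f : continuous f -> continuous (fun z => f z ^+ 2).
Proof. by move=> cf z; apply: (@cvgM _ _ _ _ f f); exact: cf. Qed.

Lemma L2loc_continuous f : continuous f -> L2loc f.
Proof.
move=> cf r r0; split.
  exact: continuous_measurable_prod (measurable_rect _ _ _ _) _.
have := continuous_integrable_rect (- r) r 0 r (continuous_sqr cf).
move=> /integrableP[_]; apply: le_lt_trans; rewrite le_eqVlt; apply/orP; left.
apply/eqP; apply: eq_integral => z _ /=.
by rewrite ger0_norm// sqr_ge0.
Qed.

Lemma H1loc_continuous u ux uy : continuous u -> continuous ux -> continuous uy ->
  (forall z, is_derive z (dirx R) u (ux z)) ->
  (forall z, is_derive z (diry R) u (uy z)) -> H1loc u ux uy.
Proof.
move=> cu cx cy dx dy; split; try exact: L2loc_continuous.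
- exact: weak_dirx.
- exact: weak_diry.
Qed.

(** The approximating sequence in the definition of the trace is constant. *)
Lemma trace_continuous u ux uy : continuous u -> continuous ux -> continuous uy ->
  (forall z, is_derive z (dirx R) u (ux z)) ->
  (forall z, is_derive z (diry R) u (uy z)) -> trace u (fun x => u (x, 0)).
Proof.
move=> cu cx cy dx dy; split.
  by apply: continuous_measurable_fun; exact: continuous_slicex.
have H := H1loc_continuous cu cx cy dx dy.
exists ux, uy; split => //; exists (fun=> u), (fun=> ux), (fun=> uy).
have cvg0 f : L2loc_cvg (fun=> f) f.
  move=> r r0; apply: cvg_near_cst; near=> n; apply: integral0_eq => z _.
  by rewrite subrr expr0n.
split => //.
- by split => //; exact: continuous_subspaceT.
- move=> r r0; apply: cvg_near_cst; near=> n; apply: integral0_eq => z _.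
  by rewrite subrr expr0n.
Unshelve. all: by end_near. Qed.

Lemma measurable_cyl eps : measurable (cyl eps : set (R * R)).
Proof. exact: measurableX. Qed.

(** A continuous function vanishing above height [Y] is square integrable on
    the half-cylinder: the integral is over a compact rectangle. *)
Lemma L2cyl_continuous eps f (Y : R) : continuous f ->
  (forall x y, Y < y -> f (x, y) = 0) -> L2cyl eps f.
Proof.
move=> cf f0; split; first exact: L2loc_continuous.
split; first exact: continuous_measurable_prod (measurable_cyl _) _.
have := continuous_integrable_rect 0 (period eps) 0 Y (continuous_sqr cf).
move=> /integrableP[_]; apply: le_lt_trans.
rewrite integral_mkcond [leRHS]integral_mkcond.
apply: ge0_le_integral => //.
- by move=> z _; rewrite patchE; case: ifP => // _; rewrite lee_fin sqr_ge0.
- have /(measurable_restrictT _ (measurable_cyl eps)) :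
      measurable_fun (cyl eps) (fun z => (f z ^+ 2)%:E).
    apply/measurable_EFinP; apply: continuous_measurable_prod.
      exact: measurable_cyl.
    exact: continuous_sqr.
  exact.
- have /(measurable_restrictT _ (measurable_rect 0 (period eps) 0 Y)) :
      measurable_fun (rect 0 (period eps) 0 Y)
        (fun z => `|(EFin \o (fun z => (f z ^+ 2)%R)) z|%E).
    apply: measurableT_comp => //.
    apply/measurable_EFinP; apply: continuous_measurable_prod.
      exact: measurable_rect.
    exact: continuous_sqr.
  exact.
- move=> [x y] _; rewrite !patchE; case: ifPn => zc; last first.
    by case: ifP => // _; exact: abse_ge0.
  move: zc; rewrite inE => -[/=].
  rewrite !in_itv /= => /andP[x0 xl]; rewrite andbT => y0.
  case: ifPn => [_|]; first by rewrite /= ger0_norm ?sqr_ge0.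
  rewrite notin_setE => h; rewrite f0 ?expr0n//.
  rewrite ltNge; apply/negP => yY; apply: h; split => /=; rewrite in_itv /=.
  + by rewrite x0 ltW.
  + by rewrite y0.
Qed.

End WeakDerivatives.

(** * Second-order jets and quasi-periodic extension *)

Section Jets.
Variable R : realType.
Implicit Types (f g : R * R -> R) (z v : R * R).

(** The value and the partial derivatives up to order two of a function of the
    plane.  A jet is only a tuple of functions; [jetP] says that they are the
    continuous derivatives that the names announce. *)
Record jet := Jet { j0 : R * R -> R; jx : R * R -> R; jy : R * R -> R;
  jxx : R * R -> R; jxy : R * R -> R; jyy : R * R -> R }.

Record jetP (J : jet) : Prop := JetP {
  jc0 : continuous (j0 J); jcx : continuous (jx J); jcy : continuous (jy J);
  jcxx : continuous (jxx J); jcxy : continuous (jxy J); jcyy : continuous (jyy J);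
  jdx : forall z, is_derive z (dirx R) (j0 J) (jx J z);
  jdy : forall z, is_derive z (diry R) (j0 J) (jy J z);
  jdxx : forall z, is_derive z (dirx R) (jx J) (jxx J z);
  jdxy : forall z, is_derive z (diry R) (jx J) (jxy J z);
  jdyx : forall z, is_derive z (dirx R) (jy J) (jxy J z);
  jdyy : forall z, is_derive z (diry R) (jy J) (jyy J z) }.

(** The jet of the affine function [a x + b y + c]. *)
Definition jaff (a b c : R) := Jet (fun z => a * z.1 + b * z.2 + c)
  (cst a) (cst b) (cst 0) (cst 0) (cst 0).

(** Jets of sums, of products, and of [S \o f] for [S] a function of one variable
    with first and second derivatives [S1] and [S2]. *)
Definition jadd (J K : jet) := Jet (fun z => j0 J z + j0 K z)
  (fun z => jx J z + jx K z) (fun z => jy J z + jy K z)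
  (fun z => jxx J z + jxx K z) (fun z => jxy J z + jxy K z)
  (fun z => jyy J z + jyy K z).

Definition jmul (J K : jet) := Jet (fun z => j0 J z * j0 K z)
  (fun z => jx J z * j0 K z + j0 J z * jx K z)
  (fun z => jy J z * j0 K z + j0 J z * jy K z)
  (fun z => (jxx J z * j0 K z + jx J z * jx K z) + (jx J z * jx K z + j0 J z * jxx K z))
  (fun z => (jxy J z * j0 K z + jx J z * jy K z) + (jy J z * jx K z + j0 J z * jxy K z))
  (fun z => (jyy J z * j0 K z + jy J z * jy K z) + (jy J z * jy K z + j0 J z * jyy K z)).

Definition jcomp (S S1 S2 : R -> R) (J : jet) := Jet (fun z => S (j0 J z))
  (fun z => S1 (j0 J z) * jx J z) (fun z => S1 (j0 J z) * jy J z)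
  (fun z => S2 (j0 J z) * jx J z * jx J z + S1 (j0 J z) * jxx J z)
  (fun z => S2 (j0 J z) * jy J z * jx J z + S1 (j0 J z) * jxy J z)
  (fun z => S2 (j0 J z) * jy J z * jy J z + S1 (j0 J z) * jyy J z).

Lemma is_derive_mulR f g z v df dg : is_derive z v f df -> is_derive z v g dg ->
  is_derive z v (fun t => f t * g t) (df * g z + f z * dg).
Proof.
move=> Df Dg; rewrite (_ : _ + _ = f z *: dg + g z *: df).
  exact: is_deriveM.
by rewrite /GRing.scale /=; ring.
Qed.

Lemma is_derive_addR f g z v df dg : is_derive z v f df -> is_derive z v g dg ->
  is_derive z v (fun t => f t + g t) (df + dg).
Proof. by move=> Df Dg; exact: is_deriveD. Qed.

Lemma is_derive_compx (S : R -> R) f z dS df :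
  is_derive (f z) 1 S dS -> is_derive z (dirx R) f df ->
  is_derive z (dirx R) (fun t => S (f t)) (dS * df).
Proof.
case: z => x y DS /is_derive_dirx Df; apply/is_derive_dirx.
exact: (@is_derive1_comp _ S (fun t => f (t, y))).
Qed.

Lemma is_derive_compy (S : R -> R) f z dS df :
  is_derive (f z) 1 S dS -> is_derive z (diry R) f df ->
  is_derive z (diry R) (fun t => S (f t)) (dS * df).
Proof.
case: z => x y DS /is_derive_diry Df; apply/is_derive_diry.
exact: (@is_derive1_comp _ S (fun t => f (x, t))).
Qed.

Lemma continuous_addR (T : topologicalType) (f g : T -> R) :
  continuous f -> continuous g -> continuous (fun z : T => f z + g z).
Proof. by move=> cf cg z; apply: cvgD; [exact: cf|exact: cg]. Qed.

Lemma continuous_mulR (T : topologicalType) (f g : T -> R) :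
  continuous f -> continuous g -> continuous (fun z : T => f z * g z).
Proof. by move=> cf cg z; apply: cvgM; [exact: cf|exact: cg]. Qed.

Lemma continuous_compR (T : topologicalType) (S : R -> R) (f : T -> R) :
  continuous S -> continuous f -> continuous (fun z : T => S (f z)).
Proof. by move=> cS cf z; apply: continuous_comp; [exact: cf|exact: cS]. Qed.

Lemma continuous_exprnR (T : topologicalType) (f : T -> R) n :
  continuous f -> continuous (fun z : T => f z ^+ n).
Proof.
move=> cf; elim: n => [|n IH]; first by move=> z; exact: cvg_cst.
rewrite (_ : (fun _ => _) = (fun z : T => f z * f z ^+ n)).
  exact: continuous_mulR.
by apply/funext => z; rewrite exprS.
Qed.

Lemma continuous_cstR (T : topologicalType) (a : R) : continuous (cst a : T -> R).
Proof. by move=> z; exact: cvg_cst. Qed.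

Lemma jaffP a b c : jetP (jaff a b c).
Proof.
have cst0 (e : R) z v : is_derive z v (cst e : R * R -> R) 0 by exact: is_derive_cst.
split => /=; try exact: continuous_cstR; try by move=> z; exact: cst0.
- apply: continuous_addR; last exact: continuous_cstR.
  apply: continuous_addR; apply: continuous_mulR; try exact: continuous_cstR.
    by move=> z; exact: cvg_fst.
  by move=> z; exact: cvg_snd.
- move=> [x y]; apply/is_derive_dirx => /=.
  have := is_deriveD (is_deriveZ a (is_derive_id x 1)) (is_derive_cst (b * y + c) x 1).
  rewrite addr0 /GRing.scale /= mulr1.
  by congr (is_derive _ _ _ _); apply/funext => t; rewrite !fctE addrA.
- move=> [x y]; apply/is_derive_diry => /=.
  have := is_deriveD (is_deriveZ b (is_derive_id y 1)) (is_derive_cst (a * x + c) y 1).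
  rewrite addr0 /GRing.scale /= mulr1.
  by congr (is_derive _ _ _ _); apply/funext => t; rewrite !fctE addrCA addrA.
Qed.

Lemma jaddP J K : jetP J -> jetP K -> jetP (jadd J K).
Proof.
move=> [a1 a2 a3 a4 a5 a6 a7 a8 a9 a10 a11 a12] [b1 b2 b3 b4 b5 b6 b7 b8 b9 b10 b11 b12].
by split; do ?exact: continuous_addR; move=> z /=; apply: is_derive_addR.
Qed.

Lemma jmulP J K : jetP J -> jetP K -> jetP (jmul J K).
Proof.
move=> [a1 a2 a3 a4 a5 a6 a7 a8 a9 a10 a11 a12] [b1 b2 b3 b4 b5 b6 b7 b8 b9 b10 b11 b12].
split.
- exact: (continuous_mulR a1 b1).
- exact: (continuous_addR (continuous_mulR a2 b1) (continuous_mulR a1 b2)).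
- exact: (continuous_addR (continuous_mulR a3 b1) (continuous_mulR a1 b3)).
- exact: (continuous_addR
    (continuous_addR (continuous_mulR a4 b1) (continuous_mulR a2 b2))
    (continuous_addR (continuous_mulR a2 b2) (continuous_mulR a1 b4))).
- exact: (continuous_addR
    (continuous_addR (continuous_mulR a5 b1) (continuous_mulR a2 b3))
    (continuous_addR (continuous_mulR a3 b2) (continuous_mulR a1 b5))).
- exact: (continuous_addR
    (continuous_addR (continuous_mulR a6 b1) (continuous_mulR a3 b3))
    (continuous_addR (continuous_mulR a3 b3) (continuous_mulR a1 b6))).
- by move=> z /=; apply: is_derive_mulR.
- by move=> z /=; apply: is_derive_mulR.
- by move=> z /=; apply: is_derive_addR; apply: is_derive_mulR.
- by move=> z /=; apply: is_derive_addR; apply: is_derive_mulR.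
- move=> z /=; rewrite [X in is_derive _ _ _ X](_ : _ = jxy J z * j0 K z +
    jy J z * jx K z + (jx J z * jy K z + j0 J z * jxy K z)); last by ring.
  by apply: is_derive_addR; apply: is_derive_mulR.
- by move=> z /=; apply: is_derive_addR; apply: is_derive_mulR.
Qed.

Lemma jcompP S S1 S2 J : (forall t : R, is_derive t 1 S (S1 t)) ->
  (forall t : R, is_derive t 1 S1 (S2 t)) -> continuous S2 ->
  jetP J -> jetP (jcomp S S1 S2 J).
Proof.
have cd (F G : R -> R) : (forall t : R, is_derive t 1 F (G t)) -> continuous F.
  move=> dF t; apply: differentiable_continuous.
  by apply/derivable1_diffP; case: (dF t).
move=> D1 D2 cS2 [b1 b2 b3 b4 b5 b6 b7 b8 b9 b10 b11 b12].
have cS := cd _ _ D1; have cS1 := cd _ _ D2.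
split.
- exact: (continuous_compR cS b1).
- exact: (continuous_mulR (continuous_compR cS1 b1) b2).
- exact: (continuous_mulR (continuous_compR cS1 b1) b3).
- exact: (continuous_addR
    (continuous_mulR (continuous_mulR (continuous_compR cS2 b1) b2) b2)
    (continuous_mulR (continuous_compR cS1 b1) b4)).
- exact: (continuous_addR
    (continuous_mulR (continuous_mulR (continuous_compR cS2 b1) b3) b2)
    (continuous_mulR (continuous_compR cS1 b1) b5)).
- exact: (continuous_addR
    (continuous_mulR (continuous_mulR (continuous_compR cS2 b1) b3) b3)
    (continuous_mulR (continuous_compR cS1 b1) b6)).
- by move=> z /=; apply: is_derive_compx.
- by move=> z /=; apply: is_derive_compy.
- move=> z /=; apply: is_derive_mulR => //; first exact: is_derive_compx.
- move=> z /=; apply: is_derive_mulR => //; first exact: is_derive_compy.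
- move=> z /=; rewrite mulrAC; apply: is_derive_mulR => //; first exact: is_derive_compx.
- move=> z /=; apply: is_derive_mulR => //; first exact: is_derive_compy.
Qed.

Lemma is_derive_shift f z v df a :
  is_derive (z.1 + a, z.2) v f df -> is_derive z v (fun t => f (t.1 + a, t.2)) df.
Proof.
have E : (fun h => h^-1 *: ((f \o shift (z.1 + a, z.2)) (h *: v) - f (z.1 + a, z.2))) =
   (fun h => h^-1 *:
     (((fun t => f (t.1 + a, t.2)) \o shift z) (h *: v) - f (z.1 + a, z.2))).
  apply/funext => h; congr (_ *: (f _ - _)).
  by rewrite /shift /=; congr pair; rewrite /= addrA.
by move=> -[dfx <-]; split; move: dfx; rewrite /derivable /derive E.
Qed.

Lemma is_derive_eq_near f g z v df dg : (\forall t \near z, f t = g t) ->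
  is_derive z v f df -> is_derive z v g dg -> df = dg.
Proof. by move=> fg Df [_ <-]; case: (near_eq_is_derive fg Df). Qed.

Lemma near_x (x y a b : R) : a < x < b -> \forall z \near (x, y), a < z.1 < b.
Proof.
move=> /andP[ax xb].
have h : nbhs (x, y) ((fun z => z.1) @^-1` `]a, b[%classic).
  have : {for (x, y), continuous (fun z : R * R => z.1)} by exact: cvg_fst.
  by apply; apply: open_nbhs_nbhs; split; [exact: interval_open|rewrite /= in_itv /= ax].
by apply: filterS h => z /=; rewrite in_itv.
Qed.

Lemma near_y (x y a : R) : a < y -> \forall z \near (x, y), a < z.2.
Proof.
move=> ay.
have h : nbhs (x, y) ((fun z => z.2) @^-1` `]a, +oo[%classic).
  have : {for (x, y), continuous (fun z : R * R => z.2)} by exact: cvg_snd.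
  by apply; apply: open_nbhs_nbhs; split; [exact: interval_open|rewrite /= in_itv /= ay].
by apply: filterS h => z /=; rewrite in_itv /= andbT.
Qed.

Section ext.
Variable (l : R).
Hypothesis l1 : 1 <= l.

(** The index, as a real number, of the period [ [n l, (n + 1) l) ] that
    contains [x]. *)
Definition cell (x : R) : R := (Num.floor (x / l))%:~R.

(** The extension of [f] from [0 <= x < l] to the plane that gains [c] over each
    period. *)
Definition pext (c : R) f z := c * cell z.1 + f (z.1 - cell z.1 * l, z.2).

(** The condition under which the extension by [pext] is as smooth as [f].  It
    is imposed on a two-sided neighbourhood of [x = 0], hence also prescribes
    [f] slightly outside of [0 <= x < l]. *)
Definition quasiper (c : R) f := forall x y, `|x| < 1/4 -> f (x + l, y) = f (x, y) + c.

Lemma cell_itv x : cell x * l <= x < (cell x + 1) * l.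
Proof.
have l0 : 0 < l by exact: lt_le_trans l1.
have /andP[h1 h2] := mem_rg1_floor (x / l).
by rewrite -ler_pdivlMr// -ltr_pdivrMr//; apply/andP; split.
Qed.

Lemma cellP x (n : int) : n%:~R * l <= x < (n%:~R + 1) * l -> cell x = n%:~R.
Proof.
have l0 : 0 < l by exact: lt_le_trans l1.
move=> h; congr (_%:~R); apply: floor_def.
by rewrite ler_pdivlMr// ltr_pdivrMr// intrD.
Qed.

Lemma cell_addl x : cell (x + l) = cell x + 1.
Proof.
have -> : cell x + 1 = (Num.floor (x / l) + 1)%:~R by rewrite intrD.
have /andP[h1 h2] := cell_itv x.
apply: cellP; rewrite intrD -/(cell x) (_ : 1%:~R = 1 :> R)//.
by rewrite !mulrDl !mul1r in h2 *; apply/andP; split; lra.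
Qed.

(** Near every point, also one with [x = n l], the extension is given by a
    single translate of [f]. *)
Lemma pext_near c f z0 : quasiper c f ->
  \forall z \near z0, pext c f z = c * cell z0.1 + f (z.1 + (- (cell z0.1 * l)), z.2).
Proof.
case: z0 => x0 y0 qf /=; set n := cell x0.
have hx := cell_itv x0; rewrite -/n in hx.
have : n * l - 1/4 < x0 < (n + 1) * l by case/andP: hx => h1 ->; rewrite andbT; lra.
move=> /(near_x y0); apply: filterS => -[x y] /= hxx; rewrite /pext /=.
(* just to the left of [n * l] the index of the period drops by one *)
have [xn|xn] := leP (n * l) x.
  rewrite (cellP (n := Num.floor (x0 / l))) // -/(cell x0) -/n xn.
  by case/andP: hxx.
have -> : cell x = n - 1.
  have -> : n - 1 = (Num.floor (x0 / l) - 1)%:~R by rewrite intrB.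
  apply: cellP; rewrite intrB -/(cell x0) -/n (_ : 1%:~R = 1 :> R)// subrK xn andbT.
  by have := l1; case/andP: hxx => h _; rewrite mulrBl mul1r; lra.
rewrite (_ : x - (n - 1) * l = (x - n * l) + l); last by ring.
rewrite qf; first by ring.
by have := l1; case/andP: hxx => h _ l1'; rewrite ltr_norml; apply/andP; split; lra.
Qed.

Lemma pext_continuous c f : quasiper c f -> continuous f -> continuous (pext c f).
Proof.
move=> qf cf z0; have E := pext_near z0 qf.
rewrite /continuous_at (nbhs_singleton E).
apply: (@cvg_trans _ ((fun z => c * cell z0.1 + f (z.1 + - (cell z0.1 * l), z.2)) @ z0)).
  by apply: near_eq_cvg; apply: filterS E => z ->.
apply: (@continuous_addR (R * R)%type (cst (c * cell z0.1))
  (fun z => f (z.1 + - (cell z0.1 * l), z.2))).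
  exact: continuous_cstR.
move=> {E}; move: (cell z0.1 * l) => a z1.
apply: (@continuous_comp _ _ _ (fun z => (z.1 - a, z.2)) f); last exact: cf.
apply: (@cvg_pair _ _ _ _ (nbhs (z1.1 - a)) (nbhs z1.2)) => /=.
  by apply: cvgB; [exact: cvg_fst|exact: cvg_cst].
exact: cvg_snd.
Qed.

Lemma pext_derive c f g v : quasiper c f -> (forall z, is_derive z v f (g z)) ->
  forall z, is_derive z v (pext c f) (pext 0 g z).
Proof.
move=> qf df z0; have E := pext_near z0 qf.
apply: (near_eq_is_derive (f := fun z => c * cell z0.1 + f (z.1 - cell z0.1 * l, z.2))).
  by apply: filterS E => z ->.
rewrite /pext mul0r; apply: is_derive_addR.
exact: is_derive_shift.
Qed.

Lemma quasiper_derive c f g v : quasiper c f -> (forall z, is_derive z v f (g z)) ->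
  quasiper 0 g.
Proof.
move=> qf df x y x1; rewrite addr0.
apply: (@is_derive_eq_near (fun z => f (z.1 + l, z.2)) (fun z => f z + c) (x, y) v).
- have : - (1/4) < x < 1/4 by rewrite -ltr_norml.
  move=> /(near_x y); apply: filterS => -[a b] /= h; apply: qf.
  by rewrite ltr_norml.
- exact: is_derive_shift.
- by rewrite -[g (x, y)]addr0; apply: is_derive_addR.
Qed.

Definition jext (c : R) J := Jet (pext c (j0 J)) (pext 0 (jx J)) (pext 0 (jy J))
  (pext 0 (jxx J)) (pext 0 (jxy J)) (pext 0 (jyy J)).

Lemma jextP c J : quasiper c (j0 J) -> jetP J -> jetP (jext c J).
Proof.
move=> q0 [b1 b2 b3 b4 b5 b6 b7 b8 b9 b10 b11 b12].
have qx := quasiper_derive q0 b7; have qy := quasiper_derive q0 b8.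
have qxx := quasiper_derive qx b9; have qxy := quasiper_derive qx b10.
have qyy := quasiper_derive qy b12.
by split; try exact: pext_continuous; exact: pext_derive.
Qed.

End ext.

End Jets.

(** * The cut-off function and the widening profile *)

Section Profiles.
Variable R : realType.
Implicit Types (f g h P p : R -> R).

Lemma cvg_is_derive f (a d : R) :
  (fun e => e^-1 *: (f (e *: 1 + a) - f a)) e @[e --> 0^'] --> d ->
  is_derive a 1 f d.
Proof. by move=> fd; split; [exact: cvgP fd|exact: cvg_lim fd]. Qed.

Lemma is_derive_cvg f (a d : R) : is_derive a 1 f d ->
  (fun e => e^-1 *: (f (e *: 1 + a) - f a)) e @[e --> 0^'] --> d.
Proof. by case=> df <-. Qed.

(** A function that agrees near [a] at each point with one of two functions
    having the same derivative at [a] has that derivative too. *)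
Lemma is_derive_glue f g h (a d : R) :
  (\forall s \near a, f s = g s \/ f s = h s) -> f a = g a -> f a = h a ->
  is_derive a 1 g d -> is_derive a 1 h d -> is_derive a 1 f d.
Proof.
move=> fgh ga ha /is_derive_cvg Dg /is_derive_cvg Dh; apply: cvg_is_derive.
have N : \forall e \near 0^',
    f (e *: 1 + a) = g (e *: 1 + a) \/ f (e *: 1 + a) = h (e *: 1 + a).
  apply: nbhs_dnbhs.
  have c : (fun e : R => e *: (1 : R) + a) @ (0 : R) --> a.
    rewrite -[X in _ --> X]add0r (_ : (fun e => _) = (fun e : R => e + a)); last first.
      by apply/funext => e; rewrite /GRing.scale /= mulr1.
    by apply: cvgD; [exact: cvg_id|exact: cvg_cst].
  exact: (c _ fgh).
move=> A nA; have {}Dg := Dg _ nA; have {}Dh := Dh _ nA.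
rewrite !nbhs_simpl /= in Dg Dh *.
apply: filterS3 Dg Dh N => e /= Ag Ah [->|->].
  by rewrite ga.
by rewrite ha.
Qed.

(** The projection of [t] to the interval [0, 1]. *)
Definition clamp (t : R) := Num.max 0 (Num.min t 1).

Lemma clamp0 t : t <= 0 -> clamp t = 0.
Proof. by move=> t0; rewrite /clamp; apply/max_idPl; rewrite ge_min t0. Qed.

Lemma clamp1 t : 1 <= t -> clamp t = 1.
Proof. by move=> t1; rewrite /clamp (min_idPr t1); apply/max_idPr. Qed.

Lemma clampE t : 0 <= t <= 1 -> clamp t = t.
Proof. by case/andP=> t0 t1; rewrite /clamp (min_idPl t1); apply/max_idPr. Qed.

Lemma clamp_itv t : 0 <= clamp t <= 1.
Proof. by rewrite /clamp le_max lexx ge_max ler01 ge_min lexx orbT. Qed.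

(** Composition with [clamp] preserves differentiability for functions that are
    flat at 0 and at 1. *)
Lemma is_derive_clamp P p : (forall t : R, is_derive t 1 P (p t)) ->
  p 0 = 0 -> p 1 = 0 ->
  forall t : R, is_derive t 1 (fun s => P (clamp s)) (p (clamp t)).
Proof.
move=> dP p0 p1 t.
have cst0 (c : R) : is_derive t 1 (cst c : R -> R) 0 by exact: is_derive_cst.
have nlt (a b : R) : a < b -> \forall s \near a, s < b by move=> ab; exact: lt_nbhsl.
have ngt (a b : R) : b < a -> \forall s \near a, b < s by move=> ab; exact: lt_nbhsr.
have [t0|t0] := ltP t 0.
  rewrite clamp0 ?(ltW t0)// p0; apply: (near_eq_is_derive (f := cst (P 0))).
  by apply: filterS (nlt _ _ t0) => s s0; rewrite clamp0// ltW.
have [t1|t1] := ltP 1 t.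
  rewrite clamp1 ?(ltW t1)// p1; apply: (near_eq_is_derive (f := cst (P 1))).
  by apply: filterS (ngt _ _ t1) => s s0; rewrite clamp1// ltW.
rewrite clampE ?t0//.
move: t0; rewrite le_eqVlt => /predU1P[t0|t0].
  subst t; rewrite p0; apply: (is_derive_glue (g := cst (P 0)) (h := P)) => //.
  - apply: filterS (nlt 0 1 ltr01).
    move=> s s1; have [s0|s0] := leP s 0; first by left; rewrite clamp0.
    by right; rewrite clampE// (ltW s0) ltW.
  - by rewrite clamp0.
  - by rewrite clamp0.
  - by have := dP 0; rewrite p0.
move: t1; rewrite le_eqVlt => /predU1P[t1|t1].
  subst t; rewrite p1; apply: (is_derive_glue (g := cst (P 1)) (h := P)) => //.
  - apply: filterS (ngt 1 0 ltr01).
    move=> s s0; have [s1|s1] := leP 1 s; first by left; rewrite clamp1.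
    by right; rewrite clampE// (ltW s0) ltW.
  - by rewrite clamp1.
  - by rewrite clamp1.
  - by have := dP 1; rewrite p1.
apply: (near_eq_is_derive (f := P)) => //.
apply: filterS2 (nlt _ _ t1) (ngt _ _ t0) => s s1 s0.
by rewrite clampE// (ltW s0) ltW.
Qed.

(** A [C^2] step from 0 (for [t <= 0]) to 1 (for [1 <= t]), and its first and
    second derivatives. *)
Definition smoothstep (t : R) := let c := clamp t in c ^+ 3 * (10 - 15 * c + 6 * c ^+ 2).
Definition smoothstep1 (t : R) := let c := clamp t in 30 * c ^+ 2 * (1 - c) ^+ 2.
Definition smoothstep2 (t : R) := let c := clamp t in 60 * c * (1 - c) * (1 - 2 * c).

Lemma is_derive_smoothstep (t : R) : is_derive t 1 smoothstep (smoothstep1 t).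
Proof.
pose q : {poly R} := 'X^3 * (10%:P - 15%:P * 'X + 6%:P * 'X^2).
have := @is_derive_clamp (horner q) (fun t => 30 * t ^+ 2 * (1 - t) ^+ 2).
rewrite (_ : (fun s => q.[clamp s]) = smoothstep); last first.
  by apply/funext => s; rewrite /smoothstep /q !hornerE /=.
apply.
- move=> s; have := is_derive_poly q s; congr is_derive.
  by rewrite /q !poly.derivE !hornerE /=; ring.
- by rewrite expr0n mulr0 mul0r.
- by rewrite subrr expr0n mulr0.
Qed.

Lemma is_derive_smoothstep1 (t : R) : is_derive t 1 smoothstep1 (smoothstep2 t).
Proof.
pose q : {poly R} := 30%:P * 'X^2 * (1 - 'X) ^+ 2.
have := @is_derive_clamp (horner q) (fun t => 60 * t * (1 - t) * (1 - 2 * t)).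
rewrite (_ : (fun s => q.[clamp s]) = smoothstep1); last first.
  by apply/funext => s; rewrite /smoothstep1 /q !hornerE /=.
apply.
- move=> s; have := is_derive_poly q s; congr is_derive.
  by rewrite /q !poly.derivE !hornerE /=; ring.
- by rewrite mulr0 !mul0r.
- by rewrite subrr mulr0 mul0r.
Qed.

Lemma continuous_clamp : continuous clamp.
Proof.
move=> t; apply: (@continuous_max R R (cst 0) (fun s => Num.min s 1)).
  exact: cvg_cst.
by apply: (@continuous_min R R id (cst 1)); [exact: cvg_id|exact: cvg_cst].
Qed.

Lemma continuous_smoothstep2 : continuous smoothstep2.
Proof.
pose q : {poly R} := 60%:P * 'X * (1 - 'X) * (1 - 2%:P * 'X).
have -> : smoothstep2 = horner q \o clamp.
  by apply/funext => s; rewrite /smoothstep2 /q /= !hornerE /=.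
by move=> t; apply: continuous_comp; [exact: continuous_clamp|exact: continuous_horner].
Qed.

Lemma smoothstep_le0 t : t <= 0 ->
  [/\ smoothstep t = 0, smoothstep1 t = 0 & smoothstep2 t = 0].
Proof.
by move=> /clamp0 h; rewrite /smoothstep /smoothstep1 /smoothstep2 h; split; ring.
Qed.

Lemma smoothstep_ge1 t : 1 <= t ->
  [/\ smoothstep t = 1, smoothstep1 t = 0 & smoothstep2 t = 0].
Proof.
by move=> /clamp1 h; rewrite /smoothstep /smoothstep1 /smoothstep2 h; split; ring.
Qed.

Lemma smoothstep_bound t :
  [/\ `|smoothstep t| <= 60, `|smoothstep1 t| <= 60 & `|smoothstep2 t| <= 60].
Proof.
have /andP[c0 c1] := clamp_itv t; rewrite /smoothstep /smoothstep1 /smoothstep2.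
have c01 : `|clamp t| <= 1 by rewrite ger0_norm.
have d01 : `|1 - clamp t| <= 1 by rewrite ger0_norm; lra.
have e01 : `|1 - 2 * clamp t| <= 1 by rewrite ler_norml; apply/andP; split; lra.
have f01 : `|10 - 15 * clamp t + 6 * clamp t ^+ 2| <= 60.
  rewrite ler_norml; apply/andP; split; nra.
have n30 : `|30| = 30 :> R by rewrite ger0_norm.
have n60 : `|60| = 60 :> R by rewrite ger0_norm.
split; rewrite !normrM ?n30 ?n60.
- rewrite -[leRHS]mul1r; apply: ler_pM;
    by rewrite ?mulr_ge0 ?mulr_ile1 ?mulr_ge0 ?mulr_ile1.
- rewrite -!mulrA (le_trans (y := 30 * 1))//; last lra.
  by rewrite ler_wpM2l// !(mulr_ile1, mulr_ge0).
- rewrite -!mulrA (le_trans (y := 60 * 1))//; last lra.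
  by rewrite ler_wpM2l// !(mulr_ile1, mulr_ge0).
Qed.

(** The function [(1 + y^2)^(-1/4)], with its first and second derivatives
    written as polynomials in [y] and [rho y].  Its inverse is the width of the
    jump at height [y], and its derivative vanishes at 0, as the Neumann
    condition requires. *)
Definition rho (y : R) : R := expR (- (ln (1 + y ^+ 2) / 4)).
Definition rho1 (y : R) : R := - (1/2) * y * rho y ^+ 5.
Definition rho2 (y : R) : R := - (1/2) * rho y ^+ 5 + 5/4 * y ^+ 2 * rho y ^+ 9.

Lemma sqr1_gt0 (y : R) : 0 < 1 + y ^+ 2.
Proof. by rewrite ltr_wpDr// sqr_ge0. Qed.

Lemma rho_gt0 y : 0 < rho y. Proof. exact: expR_gt0. Qed.

Lemma rho4 y : rho y ^+ 4 * (1 + y ^+ 2) = 1.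
Proof.
have h : rho y ^+ 4 = (1 + y ^+ 2)^-1.
  rewrite /rho -expRM_natl -[RHS]lnK ?posrE ?invr_gt0 ?sqr1_gt0//.
  rewrite lnV ?posrE ?sqr1_gt0//; congr expR; by field.
by rewrite h mulVf// gt_eqF// sqr1_gt0.
Qed.

Lemma is_derive_rho (y : R) : is_derive y 1 rho (rho1 y).
Proof.
have Dq : is_derive y 1 (fun s : R => 1 + s ^+ 2) (2 * y).
  have := is_derive_poly (1 + 'X^2) y.
  rewrite (_ : horner (1 + 'X^2) = (fun s : R => 1 + s ^+ 2)); last first.
    by apply/funext => s; rewrite !hornerE.
  by congr is_derive; rewrite !poly.derivE !hornerE /=; ring.
have Dl := @is_derive1_comp _ (@ln R) (fun s : R => 1 + s ^+ 2) y _ _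
  (is_derive1_ln (sqr1_gt0 y)) Dq.
have Dm := is_deriveZ (- (1/4)) Dl.
have := is_derive1_comp (is_derive_expR _) Dm.
have E : expR \o (- (1/4) \*: (@ln R \o (fun s : R => 1 + s ^+ 2))) = rho.
  apply/funext => s; rewrite /rho /=; congr expR.
  by rewrite /GRing.scale /=; field.
rewrite E; congr is_derive.
rewrite -[expR _]/((expR \o (- (1/4) \*: (@ln R \o (fun s : R => 1 + s ^+ 2)))) y) E.
have h : (1 + y ^+ 2)^-1 = rho y ^+ 4.
  by rewrite -[RHS](mulfK (x := 1 + y ^+ 2)) ?gt_eqF ?sqr1_gt0 // rho4 mul1r.
by rewrite h /rho1 /GRing.scale /=; field.
Qed.

Lemma is_derive_rho1 (y : R) : is_derive y 1 rho1 (rho2 y).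
Proof.
have D5 := is_deriveX 5 (is_derive_rho y).
have := is_deriveM (is_deriveZ (- (1/2)) (is_derive_id y 1)) D5.
rewrite (_ : _ * _ = rho1); last first.
  by apply/funext => s; rewrite /rho1 !fctE.
congr is_derive.
rewrite /rho2 /rho1 !fctE /GRing.scale /=; rewrite -[_ *: y]/(- (1 / 2) * y); by field.
Qed.

Lemma derive_continuous f g : (forall t : R, is_derive t 1 f (g t)) -> continuous f.
Proof.
move=> df t; apply: differentiable_continuous.
by apply/derivable1_diffP; case: (df t).
Qed.

Lemma continuous_rho : continuous rho.
Proof. exact: derive_continuous is_derive_rho. Qed.

Lemma continuous_rho2 : continuous rho2.
Proof.
have cr n := @continuous_exprnR _ _ _ n continuous_rho.
have c0 (a : R) := @continuous_cstR R R a.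
have c1 : continuous (@id R) by move=> x; exact: cvg_id.
have c2 := continuous_exprnR (n := 2) c1.
exact: (continuous_addR (continuous_mulR (c0 _) (cr 5%N))
  (continuous_mulR (continuous_mulR (c0 _) c2) (cr 9%N))).
Qed.

Lemma rho_le1 y : rho y <= 1.
Proof.
have r0 := rho_gt0 y; have := rho4 y; have y2 := sqr_ge0 y.
have r4 : 0 <= rho y ^+ 4 by rewrite exprn_ge0// ltW.
move=> E; rewrite leNgt; apply/negP => r1.
have : 1 < rho y ^+ 4 by rewrite exprn_egt1.
nra.
Qed.

Lemma rho_y2 y : y ^+ 2 * rho y ^+ 4 <= 1.
Proof.
have := rho4 y; have : 0 <= rho y ^+ 4 by rewrite exprn_ge0// ltW// rho_gt0.
by move=> ?; rewrite mulrDr mulr1 mulrC; lra.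
Qed.

Lemma rho_y y : `|y| * rho y ^+ 2 <= 1.
Proof.
have r2 : 0 <= rho y ^+ 2 by rewrite exprn_ge0// ltW// rho_gt0.
have h : (`|y| * rho y ^+ 2) ^+ 2 <= 1.
  by rewrite exprMn real_normK ?num_real// -exprM rho_y2.
by move: h; rewrite expr_le1// mulr_ge0.
Qed.

Lemma rho1_bound y : `|rho1 y| <= rho y ^+ 3.
Proof.
have r0 := rho_gt0 y; have := rho_y y.
have r2 : 0 <= rho y ^+ 2 by rewrite exprn_ge0 ?ltW.
have r3 : 0 <= rho y ^+ 3 by rewrite exprn_ge0 ?ltW.
rewrite -[X in _ * X](ger0_norm r2) -normrM ler_norml => /andP[h1 h2].
have -> : rho1 y = rho y ^+ 3 * (- (1/2) * (y * rho y ^+ 2)) by rewrite /rho1; ring.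
rewrite [X in X <= _]normrM (ger0_norm r3) ler_piMr// ler_norml; apply/andP; split; lra.
Qed.

Lemma rho2_bound y : `|rho2 y| <= 2 * rho y ^+ 5.
Proof.
have r0 := rho_gt0 y; have h := rho_y2 y.
have r5 : 0 < rho y ^+ 5 by rewrite exprn_gt0.
have -> : rho2 y = rho y ^+ 5 * (- (1/2) + 5 / 4 * (y ^+ 2 * rho y ^+ 4)).
  by rewrite /rho2; ring.
rewrite normrM (gtr0_norm r5) mulrC ler_pM2r//.
have : 0 <= y ^+ 2 * rho y ^+ 4 by rewrite mulr_ge0 ?sqr_ge0// exprn_ge0// ltW.
by move=> ?; rewrite ler_norml; apply/andP; split; lra.
Qed.

(** A bounded function whose derivative dominates [rho ^+ 3 / 4] for [y >= 0]:
    the term [- rho] has the right decay at infinity, and the term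
    [y * rho y ^+ 2] takes care of small [y]. *)
Definition rhoF (y : R) := - rho y + y * rho y ^+ 2.

Lemma is_derive_rhoF (y : R) : is_derive y 1 rhoF (1/2 * y * rho y ^+ 5 + rho y ^+ 6).
Proof.
have D2 := is_deriveX 2 (is_derive_rho y).
have := is_deriveD (is_deriveN (is_derive_rho y)) (is_deriveM (is_derive_id y 1) D2).
rewrite (_ : (- rho + _) = rhoF); last first.
  by apply/funext => s; rewrite /rhoF !fctE.
congr is_derive.
rewrite /rho1 !fctE /GRing.scale /= expr1.
have := rho4 y; set r := rho y => E.
rewrite (_ : y * (2%:R * r * (- (1 / 2) * y * r ^+ 5)) =
  r ^+ 2 * - (r ^+ 4 * (1 + y ^+ 2) - r ^+ 4)); last by field.
by rewrite E; field.
Qed.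

Lemma rhoF_ge (y : R) : 0 <= y -> rho y ^+ 3 <= 4 * (1/2 * y * rho y ^+ 5 + rho y ^+ 6).
Proof.
move=> y0; have r0 := rho_gt0 y.
rewrite (_ : 4 * _ = rho y ^+ 3 * (2 * (y * rho y ^+ 2) + 4 * rho y ^+ 3)); last by field.
apply: ler_peMr; first by rewrite exprn_ge0// ltW.
have E := rho4 y; have r1 := rho_le1 y.
have [y1|y1] := leP y 1.
  have h4 : 1/2 <= rho y ^+ 4.
    have : y ^+ 2 <= 1 by rewrite exprn_ile1.
    have : 0 <= rho y ^+ 4 by rewrite exprn_ge0 ?ltW.
    by move: E; set a := _ ^+ 4; set b := y ^+ 2; nra.
  have : rho y ^+ 4 <= rho y ^+ 3 by rewrite exprS ler_piMl// exprn_ge0// ltW.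
  have : 0 <= y * rho y ^+ 2 by rewrite mulr_ge0// exprn_ge0// ltW.
  lra.
have : 1 <= 2 * (y * rho y ^+ 2).
  have p0 : 0 <= 2 * (y * rho y ^+ 2) by rewrite mulr_ge0// mulr_ge0// exprn_ge0// ltW.
  suff : 1 <= (2 * (y * rho y ^+ 2)) ^+ 2 by rewrite expr_ge1.
  rewrite (_ : _ ^+ 2 = 4 * (y ^+ 2 * rho y ^+ 4)); last by ring.
  have : 1 <= y ^+ 2 by rewrite exprn_ege1// ltW.
  have : 0 <= rho y ^+ 4 by rewrite exprn_ge0 ?ltW.
  by move: E; set a := _ ^+ 4; set b := y ^+ 2; nra.
have : 0 <= rho y ^+ 3 by rewrite exprn_ge0 ?ltW.
lra.
Qed.

Lemma integral_rho3 (Y : R) : 0 < Y ->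
  (\int[lebesgue_measure]_(y in `[0%R, Y]) (rho y ^+ 3)%:E <= 8%:E)%E.
Proof.
move=> Y0; pose G (y : R) := 4 * (1/2 * y * rho y ^+ 5 + rho y ^+ 6).
have cr n : continuous (fun y => rho y ^+ n).
  exact: continuous_exprnR continuous_rho.
have cG : continuous G.
  have c0 (a : R) := @continuous_cstR R R a.
  have c1 : continuous (@id R) by move=> x; exact: cvg_id.
  exact: (continuous_mulR (c0 _) (continuous_addR (continuous_mulR
    (continuous_mulR (c0 _) c1) (cr _)) (cr _))).
apply: (@le_trans _ _ (\int[lebesgue_measure]_(y in `[0%R, Y]) (G y)%:E)%E).
  apply: ge0_le_integral => //.
  - by move=> y _; rewrite lee_fin exprn_ge0// ltW// rho_gt0.
  - by apply/measurable_EFinP; apply: measurable_funTS; exact: continuous_measurable_fun.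
  - by apply/measurable_EFinP; apply: measurable_funTS; exact: continuous_measurable_fun.
  - by move=> y /=; rewrite in_itv /= => /andP[y0 _]; rewrite lee_fin; exact: rhoF_ge.
have dG (t : R) : is_derive t 1 (fun y => 4 * rhoF y) (G t).
  exact: (is_deriveZ 4 (is_derive_rhoF t)).
rewrite (integral_FTC Y0 cG dG).
rewrite -EFinB lee_fin /rhoF.
have := rho_y Y; rewrite (gtr0_norm Y0).
have := rho_gt0 Y; have := rho_le1 0; have := rho_gt0 0.
set a := Y * _; lra.
Qed.

End Profiles.

(** * Parabolically scaled bounds *)

Section ScaledBounds.
Variable R : realType.
Implicit Types (J K : jet R) (z : R * R).

(** Bounds at parabolic scale [t] at the point [z]: an [x]-derivative counts for
    [t] and a [y]-derivative for [t ^+ 2].  For [t <= 1] this class is stable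
    under products and compositions. The second [y]-derivative is only asked to
    be of order [t ^+ 2], which is what the energy needs, and the mixed
    derivative does not occur in the energy. *)
Definition scaled_deriv (M t : R) J z :=
  [/\ `|jx J z| <= M * t, `|jy J z| <= M * t ^+ 2,
  `|jxx J z| <= M * t ^+ 2 & `|jyy J z| <= M * t ^+ 2].
Definition scaled (M t : R) J z := `|j0 J z| <= M /\ scaled_deriv M t J z.

Section scaled.
Variables (t : R) (z : R * R).
Hypothesis t01 : 0 <= t <= 1.

Lemma scaled_deriv_le M N J : M <= N -> scaled_deriv M t J z -> scaled_deriv N t J z.
Proof.
have /andP[t0 _] := t01; have t2 := sqr_ge0 t.
by move=> MN [h1 h2 h3 h4]; split; [apply: (le_trans h1)|apply: (le_trans h2)|
  apply: (le_trans h3)|apply: (le_trans h4)]; rewrite ler_wpM2r.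
Qed.

Lemma scaled_le M N J : M <= N -> scaled M t J z -> scaled N t J z.
Proof. by move=> MN [h1 h2]; split; [exact: le_trans MN|exact: scaled_deriv_le h2]. Qed.

Lemma scaled_add M N J K :
  scaled M t J z -> scaled N t K z -> scaled (M + N) t (jadd J K) z.
Proof.
move=> [a0 [a1 a2 a3 a4]] [b0 [b1 b2 b3 b4]].
by split; [|split]; rewrite /= ?mulrDl (le_trans (ler_normD _ _))// lerD.
Qed.

Lemma scaled_mul M N J K :
  scaled M t J z -> scaled N t K z -> scaled (4 * (M * N)) t (jmul J K) z.
Proof.
have /andP[t0 t1] := t01; have t2 := sqr_ge0 t.
have t21 : t ^+ 2 <= 1 by rewrite exprn_ile1.
move=> [a0 [a1 a2 a3 a4]] [b0 [b1 b2 b3 b4]].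
have M0 : 0 <= M by exact: le_trans a0.
have N0 : 0 <= N by exact: le_trans b0.
have MN0 : 0 <= M * N by rewrite mulr_ge0.
have PM (a b A B : R) : `|a| <= A -> `|b| <= B -> `|a * b| <= A * B.
  by move=> aA bB; rewrite normrM ler_pM.
have MNt : 0 <= M * N * t by rewrite mulr_ge0.
have MNt2 : 0 <= M * N * t ^+ 2 by rewrite mulr_ge0.
have Q : M * t ^+ 2 * (N * t ^+ 2) <= M * N * t ^+ 2.
  rewrite (_ : _ * _ = M * N * t ^+ 2 * t ^+ 2); last by ring.
  exact: ler_piMr.
split; [|split] => /=.
- by apply: le_trans (PM _ _ _ _ a0 b0) _; lra.
- apply: le_trans (ler_normD _ _) _.
  have := PM _ _ _ _ a1 b0; have := PM _ _ _ _ a0 b1; lra.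
- apply: le_trans (ler_normD _ _) _.
  have := PM _ _ _ _ a2 b0; have := PM _ _ _ _ a0 b2; lra.
- apply: le_trans (ler_normD _ _) _.
  have := ler_normD (jxx J z * j0 K z) (jx J z * jx K z).
  have := ler_normD (jx J z * jx K z) (j0 J z * jxx K z).
  have := PM _ _ _ _ a3 b0; have := PM _ _ _ _ a0 b3; have := PM _ _ _ _ a1 b1.
  rewrite (_ : M * t * (N * t) = M * N * t ^+ 2); last by ring.
  lra.
- apply: le_trans (ler_normD _ _) _.
  have := ler_normD (jyy J z * j0 K z) (jy J z * jy K z).
  have := ler_normD (jy J z * jy K z) (j0 J z * jyy K z).
  have := PM _ _ _ _ a4 b0; have := PM _ _ _ _ a0 b4; have := PM _ _ _ _ a2 b2.
  lra.
Qed.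

Lemma scaled_comp M S S1 S2 J : 1 <= M -> `|S (j0 J z)| <= 60 ->
  `|S1 (j0 J z)| <= 60 -> `|S2 (j0 J z)| <= 60 -> scaled_deriv M t J z ->
  scaled (120 * M ^+ 2) t (jcomp S S1 S2 J) z.
Proof.
have /andP[t0 t1] := t01; have t2 := sqr_ge0 t.
have t21 : t ^+ 2 <= 1 by rewrite exprn_ile1.
move=> M1 s0 s1 s2 [b1 b2 b3 b4].
have PM (a b A B : R) : `|a| <= A -> `|b| <= B -> `|a * b| <= A * B.
  by move=> aA bB; rewrite normrM ler_pM.
have M0 : 0 <= M by lra.
have MM : M <= M ^+ 2 by rewrite expr2 ler_peMl.
have MMt : M * t <= M ^+ 2 * t by rewrite ler_wpM2r.
have MMt2 : M * t ^+ 2 <= M ^+ 2 * t ^+ 2 by rewrite ler_wpM2r.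
have Mt : 0 <= M ^+ 2 * t by rewrite mulr_ge0// sqr_ge0.
have Mt2 : 0 <= M ^+ 2 * t ^+ 2 by rewrite mulr_ge0 ?sqr_ge0.
have Q : M * t ^+ 2 * (M * t ^+ 2) <= M ^+ 2 * t ^+ 2.
  rewrite (_ : _ * _ = M ^+ 2 * t ^+ 2 * t ^+ 2); last by ring.
  exact: ler_piMr.
split; [|split] => /=.
- lra.
- have := PM _ _ _ _ s1 b1; lra.
- have := PM _ _ _ _ s1 b2; lra.
- apply: le_trans (ler_normD _ _) _.
  have := PM _ _ _ _ (PM _ _ _ _ s2 b1) b1; have := PM _ _ _ _ s1 b3.
  rewrite (_ : 60 * (M * t) * (M * t) = 60 * (M ^+ 2 * t ^+ 2)); last by ring.
  lra.
- apply: le_trans (ler_normD _ _) _.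
  have := PM _ _ _ _ (PM _ _ _ _ s2 b2) b2; have := PM _ _ _ _ s1 b4.
  rewrite -(mulrA 60); lra.
Qed.

(** Where the outer function is flat, nothing is required of the inner jet. *)
Lemma scaled_comp_flat S S1 S2 J : `|S (j0 J z)| <= 60 -> S1 (j0 J z) = 0 ->
  S2 (j0 J z) = 0 -> scaled 60 t (jcomp S S1 S2 J) z.
Proof.
have /andP[t0 t1] := t01; have t2 := sqr_ge0 t.
move=> s0 s1 s2; split => //.
by split; rewrite /= s1 ?s2 !mul0r ?addr0 normr0 mulr_ge0.
Qed.

Lemma scaled_cst c : scaled `|c| t (jaff 0 0 c) z.
Proof.
have /andP[t0 t1] := t01; have t2 := sqr_ge0 t.
split; [|split]; rewrite /= ?mul0r ?add0r ?normr0// mulr_ge0//.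
Qed.

Lemma scaled_neg M J : scaled M t J z -> scaled (4 * M) t (jmul (jaff 0 0 (-1)) J) z.
Proof. by move=> /(scaled_mul (scaled_cst (-1))); rewrite normrN1 mul1r. Qed.

(** Vanishing at [z] of all the entries that [scaled] refers to. *)
Definition jzero J := [/\ j0 J z = 0, jx J z = 0, jy J z = 0, jxx J z = 0 & jyy J z = 0].

Lemma jzero_scaled J : jzero J -> scaled 0 t J z.
Proof.
by move=> [h0 h1 h2 h3 h4]; split; [|split]; rewrite ?h0 ?h1 ?h2 ?h3 ?h4 normr0 ?mul0r.
Qed.

Lemma jzeroMl J K : jzero J -> jzero (jmul J K).
Proof.
by move=> [h0 h1 h2 h3 h4]; split; rewrite /= ?h0 ?h1 ?h2 ?h3 ?h4 ?mul0r ?addr0.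
Qed.

Lemma jzeroMr J K : jzero J -> jzero (jmul K J).
Proof.
by move=> [h0 h1 h2 h3 h4]; split; rewrite /= ?h0 ?h1 ?h2 ?h3 ?h4 ?mulr0 ?addr0.
Qed.

(** The energy density of [y + P], for [P] the function of the jet [J]. *)
Lemma density_bound C J : scaled C t J z ->
  (jxx J z + jyy J z) ^+ 2 + (1 - (jx J z ^+ 2 + (1 + jy J z) ^+ 2)) ^+ 2 <=
  ((2 * C) ^+ 2 + (2 * C + 2 * C ^+ 2) ^+ 2) * t ^+ 4.
Proof.
have /andP[t0 t1] := t01; have t2 := sqr_ge0 t.
have t21 : t ^+ 2 <= 1 by rewrite exprn_ile1.
move=> [h0 [h1 h2 h3 h4]].
have C0 : 0 <= C by exact: le_trans h0.
have sq (a A : R) : `|a| <= A -> a ^+ 2 <= A ^+ 2.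
  by move=> aA; rewrite -real_normK ?num_real// lerXn2r// nnegrE// (le_trans _ aA).
have H1 : `|jxx J z + jyy J z| <= 2 * C * t ^+ 2.
  by apply: le_trans (ler_normD _ _) _; lra.
have H2 : `|1 - (jx J z ^+ 2 + (1 + jy J z) ^+ 2)| <= (2 * C + 2 * C ^+ 2) * t ^+ 2.
  rewrite (_ : 1 - _ = - (2 * jy J z + jy J z ^+ 2 + jx J z ^+ 2)); last by ring.
  rewrite normrN.
  have := ler_normD (2 * jy J z + jy J z ^+ 2) (jx J z ^+ 2).
  have := ler_normD (2 * jy J z) (jy J z ^+ 2).
  rewrite normrM (ger0_norm (ler0n _ 2)) !(ger0_norm (sqr_ge0 _)).
  have := sq _ _ h1; have := sq _ _ h2.
  have : (C * t ^+ 2) ^+ 2 <= C ^+ 2 * t ^+ 2.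
    rewrite (_ : (C * t ^+ 2) ^+ 2 = C ^+ 2 * t ^+ 2 * t ^+ 2); last by ring.
    by apply: ler_piMr => //; rewrite mulr_ge0 ?sqr_ge0.
  rewrite (_ : (C * t) ^+ 2 = C ^+ 2 * t ^+ 2); last by ring.
  lra.
rewrite (_ : _ * t ^+ 4 =
  (2 * C * t ^+ 2) ^+ 2 + ((2 * C + 2 * C ^+ 2) * t ^+ 2) ^+ 2); last by ring.
by apply: lerD; apply: sq.
Qed.

End scaled.

End ScaledBounds.

(** * The competitor *)

Section Competitor.
Variable R : realType.

Section competitor.
Variable eps : R.
Hypothesis eps01 : 0 < eps <= 1.

Let l := period eps.
(** The vertical slope at infinity and its defect from 1, called [k] in the
    introduction. *)
Definition slope := Num.sqrt (1 - eps ^+ 2).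
Definition slope_defect := 1 - slope.

Lemma eps_gt0 : 0 < eps. Proof. by case/andP: eps01. Qed.

Lemma eps_period : eps * l = pi.
Proof. by rewrite /l /period mulrC divfK// gt_eqF// eps_gt0. Qed.

Lemma period_ge2 : 2 <= l.
Proof.
have e0 := eps_gt0; have e1 : eps <= 1 by case/andP: eps01.
by rewrite /l /period ler_pdivlMr//; have := pi_ge2 R; lra.
Qed.

Lemma slope_defect_bound : 0 <= slope_defect <= eps ^+ 2.
Proof.
have e0 := eps_gt0; have e1 : eps <= 1 by case/andP: eps01.
have e2 : 0 <= eps ^+ 2 by rewrite sqr_ge0.
have e21 : eps ^+ 2 <= 1 by rewrite exprn_ile1// ltW.
have s0 : 0 <= slope by rewrite sqrtr_ge0.
have s2 : slope ^+ 2 = 1 - eps ^+ 2 by rewrite sqr_sqrtr//; lra.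
have s1 : slope <= 1 by rewrite -sqrtr1 ler_wsqrtr//; lra.
rewrite /slope_defect; apply/andP; split; first lra.
have h : slope ^+ 2 <= slope by rewrite expr2 ler_piMl.
lra.
Qed.

Notation jcst c := (jaff (0 : R) 0 c).
Notation jneg J := (jmul (jcst (-1)) J).
Notation jS J := (jcomp (@smoothstep R) (@smoothstep1 R) (@smoothstep2 R) J).

(** The ingredients of the competitor, with [smoothstep] as [S]: [jphi] is the
    widening jump [phi] and [jarg] the argument of [S] in it, [jtau] is the
    cut-off [tau], [jgap] the difference [eps x - k y - phi] between the linear
    phase and [y + phi], and [jneumann] the boundary corrector [B], which is
    [y (1 - S y) (1 - plateau x)]; the plateau vanishes for [x <= 1/4] and for
    [l - 2 <= x].  The jump takes place for [x] between
    [l - 1/4 - (eps + rho y)^-1] and [l - 1/4]; adding [eps] to [rho y] keeps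
    this interval inside one period at all heights.  Finally [jcell] is [Theta]
    and [jphase] its quasi-periodic extension. *)
Definition jrho := jcomp (@rho R) (@rho1 R) (@rho2 R) (jaff 0 1 0).
Definition jarg := jadd (jcst 1) (jmul (jaff 1 0 (- (l - 1/4))) (jadd (jcst eps) jrho)).
Definition jphi := jmul (jcst pi) (jS jarg).
Definition jtau := jS (jaff 0 (eps ^+ 2) 0).
Definition jgap := jadd (jaff eps (- slope_defect) 0) (jneg jphi).
Definition jcut := jadd (jcst 1) (jneg (jS (jaff 0 1 0))).
Definition jplateau := jmul (jS (jaff 1 0 (- (1/4)))) (jS (jaff (-1) 0 (l - 2))).
Definition jneumann := jmul (jmul (jaff 0 1 0) jcut) (jadd (jcst 1) (jneg jplateau)).
Definition jpert := jadd (jadd jphi (jmul jtau jgap)) (jneg jneumann).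
Definition jcell := jadd (jaff 0 1 0) jpert.
Definition jphase := jext l pi jcell.

Lemma jSP J : jetP J -> jetP (jS J).
Proof.
apply: jcompP; [exact: is_derive_smoothstep|exact: is_derive_smoothstep1|].
exact: continuous_smoothstep2.
Qed.

Lemma jphiP : jetP jphi.
Proof.
apply: jmulP; first exact: jaffP.
apply: jSP; apply: jaddP; first exact: jaffP.
apply: jmulP; first exact: jaffP.
apply: jaddP; first exact: jaffP.
by apply: jcompP; [exact: is_derive_rho|exact: is_derive_rho1|
  exact: continuous_rho2|exact: jaffP].
Qed.

Lemma jcellP : jetP jcell.
Proof.
have pN J : jetP J -> jetP (jneg J) by apply: jmulP; exact: jaffP.
have pA := jaffP.
exact: jaddP (pA _ _ _ _) (jaddP
  (jaddP jphiP (jmulP (jSP (pA _ _ _ _)) (jaddP (pA _ _ _ _) (pN _ jphiP))))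
  (pN _ (jmulP
    (jmulP (pA _ _ _ _) (jaddP (pA _ _ _ _) (pN _ (jSP (pA _ _ _ _)))))
    (jaddP (pA _ _ _ _) (pN _ (jmulP (jSP (pA _ _ _ _)) (jSP (pA _ _ _ _)))))))).
Qed.

Let phi x y := pi * smoothstep (1 + (x - (l - 1/4)) * (eps + rho y)).
Let tau y := smoothstep (eps ^+ 2 * y).
Let plateau x := smoothstep (x - 1/4) * smoothstep (l - 2 - x).

Lemma jphi0 x y : j0 jphi (x, y) = phi x y.
Proof.
rewrite /phi /= !mul0r !add0r mul1r; congr (_ * smoothstep (_ + _ * (_ + rho _))); ring.
Qed.

Lemma jcell0 x y : j0 jcell (x, y) =
  y + phi x y + tau y * (eps * x - slope_defect * y - phi x y)
  - y * (1 - smoothstep y) * (1 - plateau x).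
Proof.
rewrite -jphi0 /tau /plateau.
have E1 : x - 1/4 = 1 * x + 0 * y + - (1/4) by ring.
have E2 : l - 2 - x = -1 * x + 0 * y + (l - 2) by ring.
have E3 : eps ^+ 2 * y = 0 * x + eps ^+ 2 * y + 0 by ring.
have E4 : smoothstep y = smoothstep (0 * x + 1 * y + 0) by congr smoothstep; ring.
rewrite E1 E2 E3 E4; set P := j0 jphi _.
rewrite /jcell /jpert /jneumann /jcut /jplateau /jtau /jgap.
cbn [j0 jadd jmul jaff jcomp fst snd]; rewrite -/P; ring.
Qed.

(** The jump starts at a positive distance from the left end of the period,
    because [eps * (l - 1/2)], which is [pi - eps / 2], is at least 1. *)
Lemma phi_left x y : x <= 1/4 -> phi x y = 0.
Proof.
move=> x1; have l2 := period_ge2; have e0 := eps_gt0; have r0 := rho_gt0 y.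
have e1 : eps <= 1 by case/andP: eps01.
have el := eps_period; have p2 := pi_ge2 R.
have h : 1 + (x - (l - 1/4)) * (eps + rho y) <= 0.
  have : (l - 1/2) * eps <= (l - 1/4 - x) * (eps + rho y) by apply: ler_pM; lra.
  rewrite mulrBl (mulrC l) el; lra.
by rewrite /phi; have [-> _ _] := smoothstep_le0 h; rewrite mulr0.
Qed.

Lemma phi_right x y : l - 1/4 <= x -> phi x y = pi.
Proof.
move=> x1; have e0 := eps_gt0; have r0 := rho_gt0 y.
have h : 1 <= 1 + (x - (l - 1/4)) * (eps + rho y).
  by rewrite lerDl mulr_ge0 ?subr_ge0//; lra.
by rewrite /phi; have [-> _ _] := smoothstep_ge1 h; rewrite mulr1.
Qed.

(** On the boundary the jump lies in [l - 2 <= x]. *)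
Lemma phi_bottom x : x <= l - 2 -> phi x 0 = 0.
Proof.
move=> x1; have e0 := eps_gt0; have r1 : rho 0 = 1 :> R.
  by rewrite /rho expr0n /= addr0 ln1 mul0r oppr0 expR0.
have h : 1 + (x - (l - 1/4)) * (eps + rho 0) <= 0.
  by rewrite r1; have : 1 * 1 <= (l - 1/4 - x) * (eps + 1); [apply: ler_pM; lra|lra].
by rewrite /phi; have [-> _ _] := smoothstep_le0 h; rewrite mulr0.
Qed.

Lemma plateau_left x : x <= 1/4 -> plateau x = 0.
Proof.
move=> x1; have h : x - 1/4 <= 0 by lra.
by rewrite /plateau; have [-> _ _] := smoothstep_le0 h; rewrite mul0r.
Qed.

Lemma plateau_right x : l - 2 <= x -> plateau x = 0.
Proof.
move=> x1; have h : l - 2 - x <= 0 by lra.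
by rewrite /plateau; have [-> _ _] := smoothstep_le0 h; rewrite mulr0.
Qed.

Lemma quasiper_jcell : quasiper l pi (j0 jcell).
Proof.
move=> x y; rewrite ltr_norml => /andP[x1 x2]; rewrite !jcell0.
rewrite phi_right; last lra.
rewrite phi_left; last lra.
rewrite plateau_right; last lra.
rewrite plateau_left; last lra.
rewrite (_ : eps * (x + l) = eps * x + pi); last by rewrite mulrDr eps_period.
ring.
Qed.

Lemma jphaseP : jetP jphase.
Proof.
apply: jextP.
- by have := period_ge2; lra.
- exact: quasiper_jcell.
- exact: jcellP.
Qed.

Lemma j0_phase_shift x y : j0 jphase (x + l, y) = j0 jphase (x, y) + pi.
Proof.
rewrite /= /pext /= cell_addl; last by have := period_ge2; lra.
rewrite (_ : x + l - _ = x - cell l x * l); last by ring.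
by rewrite mulrDr mulr1; ring.
Qed.

Lemma cell0 x : 0 <= x < l -> cell l x = 0.
Proof.
move=> x0l; have l1 : 1 <= l by have := period_ge2; lra.
by rewrite (@cellP _ l l1 x 0)// mul0r add0r mul1r.
Qed.

Lemma pext_cell0 c f x y : 0 <= x < l -> pext l c f (x, y) = f (x, y).
Proof. by move=> /cell0 h; rewrite /pext /= h mulr0 mul0r subr0 add0r. Qed.

Lemma phase_linear x y : 1 / eps ^+ 2 <= y ->
  j0 jphase (x, y) = eps * x + slope * y.
Proof.
move=> yY; have e0 := eps_gt0; have e1 : eps <= 1 by case/andP: eps01.
have e2 : 0 < eps ^+ 2 by rewrite exprn_gt0.
have e21 : eps ^+ 2 <= 1 by rewrite exprn_ile1// ltW.
have h1 : 1 <= eps ^+ 2 * y by rewrite mulrC -ler_pdivrMr.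
have h2 : 1 <= y by nra.
rewrite /= /pext /=; set n := cell l x.
change (pi * n + j0 jcell (x - n * l, y) = eps * x + slope * y).
rewrite jcell0 /tau; have [-> _ _] := smoothstep_ge1 h1.
have [-> _ _] := smoothstep_ge1 h2.
rewrite (_ : eps * (x - n * l) = eps * x - n * pi); last by rewrite -eps_period; ring.
rewrite /slope_defect; ring.
Qed.

Lemma phase_bottom x : 0 <= x <= l - 2 -> j0 jphase (x, 0) = 0.
Proof.
move=> /andP[x0 xl]; rewrite [LHS](@pext_cell0 _ _ _ _); last by rewrite x0; lra.
rewrite jcell0 phi_bottom// /tau mulr0.
have [-> _ _] := smoothstep_le0 (lexx (0 : R)); ring.
Qed.

Lemma phase_y_bottom x : l - 2 <= x < l -> jy jphase (x, 0) = 0.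
Proof.
move=> /andP[x0 xl]; have l2 := period_ge2.
rewrite [LHS](@pext_cell0 _ _ _ _); last by apply/andP; split; lra.
have r0 : rho1 0 = 0 :> R by rewrite /rho1 mulr0 mul0r.
have [s0 s1 _] := smoothstep_le0 (lexx (0 : R)).
have h : -1 * x + 0 * 0 + (l - 2) <= 0 by lra.
have [p0 p1 _] := smoothstep_le0 h.
have E3 : 0 * x + eps ^+ 2 * 0 + 0 = 0 by ring.
have E4 : 0 * x + 1 * 0 + 0 = 0 by ring.
(* the only [y]-dependence of [phi] is through [rho], flat at 0 *)
have phiy : jy jphi (x, 0) = 0.
  by rewrite /= E4 r0 !(mul0r, mulr0, addr0, add0r).
rewrite /jcell /jpert /jneumann /jcut /jplateau /jtau /jgap.
cbn [j0 jy jadd jmul jaff jcomp fst snd]; rewrite phiy; set P := j0 jphi _.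
rewrite /cst E3 E4 s0 s1 p0 p1; ring.
Qed.

End competitor.

End Competitor.

(** * Scaled bounds on the competitor *)

Section CompetitorBounds.
Variable R : realType.
Notation jcst c := (jaff (0 : R) 0 c).
Notation jneg J := (jmul (jcst (-1)) J).
Notation jS J := (jcomp (@smoothstep R) (@smoothstep1 R) (@smoothstep2 R) J).

Section bounds.
Variable eps : R.
Hypothesis eps01 : 0 < eps <= 1.
Let l := period eps.
Variables x y : R.
Hypothesis x0l : 0 <= x < l.
Hypothesis y0Y : 0 <= y <= 1 / eps ^+ 2.

Lemma eps2y : eps ^+ 2 * y <= 1.
Proof.
have e2 : 0 < eps ^+ 2 by rewrite exprn_gt0// eps_gt0.
by case/andP: y0Y => _; rewrite ler_pdivlMr// mulrC.
Qed.

Lemma eps_le_rho : eps <= 2 * rho y.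
Proof.
have e0 := eps_gt0 eps01; have r0 := rho_gt0 y; have E := rho4 y.
have e1 : eps <= 1 by case/andP: eps01.
have h := eps2y; have y0 : 0 <= y by case/andP: y0Y.
have h2 : (eps ^+ 2 * y) ^+ 2 <= 1 by rewrite exprn_ile1// mulr_ge0// sqr_ge0.
have e41 : eps ^+ 4 <= 1 by rewrite exprn_ile1// ltW.
(* compare with [rho y ^+ 4 * (1 + y ^+ 2) = 1] *)
have h3 : eps ^+ 4 * (1 + y ^+ 2) <= 2.
  by rewrite (_ : _ * _ = eps ^+ 4 + (eps ^+ 2 * y) ^+ 2); [lra|ring].
rewrite leNgt; apply/negP => lt.
have : (2 * rho y) ^+ 4 < eps ^+ 4 by rewrite ltrXn2r// ?nnegrE//; lra.
rewrite (_ : _ ^+ 4 = 16 * rho y ^+ 4); last by ring.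
move=> lt4; have y2 := sqr1_gt0 y.
have : 16 * rho y ^+ 4 * (1 + y ^+ 2) < eps ^+ 4 * (1 + y ^+ 2) by rewrite ltr_pM2r.
rewrite -mulrA E; lra.
Qed.

Lemma jargE : [/\ j0 (jarg eps) (x, y) = 1 + (x - (l - 1/4)) * (eps + rho y),
  jx (jarg eps) (x, y) = eps + rho y,
  jy (jarg eps) (x, y) = (x - (l - 1/4)) * rho1 y,
  jxx (jarg eps) (x, y) = 0 &
  jyy (jarg eps) (x, y) = (x - (l - 1/4)) * rho2 y].
Proof.
have E : 0 * x + 1 * y + 0 = y by ring.
by split; rewrite /= /cst E -/l; ring.
Qed.

(** A condition met wherever [phi] varies or [B] does not vanish, and the scale
    used at each point. *)
Definition core := (x <= 2) || (l - 3 - (rho y)^-1 <= x).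
Definition scale := if core then rho y else eps.

Lemma scale01 : 0 < scale <= 1.
Proof.
by rewrite /scale; case: ifP => _ //; rewrite rho_gt0 rho_le1.
Qed.

Lemma eps_le_scale : eps <= 2 * scale.
Proof.
have e0 := eps_gt0 eps01.
by rewrite /scale; case: ifP => _; [exact: eps_le_rho|lra].
Qed.

Let t01 : 0 <= scale <= 1.
Proof. by have /andP[/ltW -> ->] := scale01. Qed.

(** Where the profile varies, [x - l + 1/4] is at most [(rho y)^-1] in absolute
    value, and this compensates the derivatives of [rho]. *)
Lemma scaled_step : scaled 1080 scale (jS (jarg eps)) (x, y).
Proof.
have e0 := eps_gt0 eps01; have r0 := rho_gt0 y; have r1 := rho_le1 y.
have [b0 b1 b2] := smoothstep_bound (j0 (jarg eps) (x, y)).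
have [E0 Ex Ey Exx Eyy] := jargE.
have [s0|s0] := leP (j0 (jarg eps) (x, y)) 0.
  have [_ z1 z2] := smoothstep_le0 s0.
  by apply: (scaled_le t01 _ (scaled_comp_flat t01 b0 z1 z2)); lra.
have [s1|s1] := leP 1 (j0 (jarg eps) (x, y)).
  have [_ z1 z2] := smoothstep_ge1 s1.
  by apply: (scaled_le t01 _ (scaled_comp_flat t01 b0 z1 z2)); lra.
set u := x - (l - 1/4) in E0 Ey Eyy.
rewrite E0 in s0 s1.
have u0 : u < 0 by rewrite -(pmulr_llt0 (x := eps + rho y))//; lra.
have ur : - u * rho y <= 1.
  have : 0 <= - u * eps by rewrite mulr_ge0//; lra.
  lra.
(* a point where the profile varies lies in the core *)
have hs : scale = rho y.
  rewrite /scale /core; case: ifP => // /negbT; rewrite negb_or -!ltNge => /andP[_ h].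
  have : - u <= (rho y)^-1 by rewrite -[leRHS]mul1r ler_pdivlMr.
  rewrite /u in h *; lra.
rewrite (_ : 1080 = 120 * 3 ^+ 2); last by ring.
have el := eps_le_scale; rewrite hs in el.
apply: scaled_comp => //; first lra.
have r2 : 0 < rho y ^+ 2 by rewrite exprn_gt0.
have au : `|u| * rho y <= 1 by rewrite ltr0_norm.
have rk k : rho y ^+ k <= 1 by rewrite exprn_ile1// ltW.
split.
- by rewrite Ex hs ger0_norm; lra.
- rewrite Ey normrM hs; apply: (le_trans (y := `|u| * rho y ^+ 3)).
    by rewrite ler_wpM2l// rho1_bound.
  rewrite (_ : _ * rho y ^+ 3 = `|u| * rho y * rho y ^+ 2); last by ring.
  by apply: ler_pM; rewrite ?mulr_ge0// ?ltW//; lra.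
- by rewrite Exx normr0 mulr_ge0// sqr_ge0.
- rewrite Eyy normrM hs; apply: (le_trans (y := `|u| * (2 * rho y ^+ 5))).
    by rewrite ler_wpM2l// rho2_bound.
  rewrite (_ : _ * (2 * rho y ^+ 5) =
    `|u| * rho y * (2 * (rho y ^+ 2 * rho y ^+ 2))); last by ring.
  apply: (le_trans (y := 1 * (2 * rho y ^+ 2))); last lra.
  apply: ler_pM; rewrite ?mulr_ge0// ?(ltW r0) ?(ltW r2)//.
  by rewrite ler_wpM2l// ler_piMr// ltW.
Qed.

Lemma scaled_tau : scaled 1920 scale (jtau eps) (x, y).
Proof.
have e0 := eps_gt0 eps01; have el := eps_le_scale; have /andP[t0 _] := t01.
rewrite (_ : 1920 = 120 * 4 ^+ 2); last by ring.
have [b0 b1 b2] := smoothstep_bound (j0 (jaff 0 (eps ^+ 2) 0) (x, y)).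
apply: scaled_comp => //; first lra.
have t2 := sqr_ge0 scale.
have h : eps ^+ 2 <= 4 * scale ^+ 2.
  rewrite (_ : 4 * _ = (2 * scale) ^+ 2); last by ring.
  by rewrite lerXn2r// nnegrE; lra.
split; rewrite /= /cst ?normr0 ?mulr_ge0//.
by rewrite ger0_norm// sqr_ge0.
Qed.

Lemma scaled_linear : scaled (pi + 4) scale (jaff eps (- slope_defect eps) 0) (x, y).
Proof.
have e0 := eps_gt0 eps01; have el := eps_le_scale; have /andP[t0 _] := t01.
have t2 := sqr_ge0 scale; have p0 := pi_ge0 R.
have h : eps ^+ 2 <= 4 * scale ^+ 2.
  rewrite (_ : 4 * _ = (2 * scale) ^+ 2); last by ring.
  by rewrite lerXn2r// nnegrE; lra.
have /andP[k0 k1] := slope_defect_bound eps01.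
have /andP[x0 xl] := x0l; have /andP[y0 _] := y0Y.
have P4 (u : R) : 0 <= u -> 4 * u <= (pi + 4) * u by move=> u0; rewrite ler_wpM2r//; lra.
have P4t := P4 _ t0; have P4t2 := P4 _ t2.
have Q (u : R) : 0 <= u -> 0 <= (pi + 4) * u by move=> u0; rewrite mulr_ge0//; lra.
split; [|split]; rewrite /= /cst ?normr0 ?Q//.
- have ex : 0 <= eps * x by rewrite mulr_ge0// ltW.
  have ex2 : eps * x <= pi by rewrite -(eps_period eps01) ler_wpM2l// ltW.
  have ky : 0 <= slope_defect eps * y by rewrite mulr_ge0.
  have ky2 : slope_defect eps * y <= 1 by apply: le_trans eps2y; rewrite ler_wpM2r.
  rewrite addr0 ler_norml; apply/andP; split; lra.
- rewrite ger0_norm; lra.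
- rewrite normrN ger0_norm//; lra.
Qed.

Lemma jneumann_off_core : ~~ core -> jzero (x, y) (jneumann eps).
Proof.
move=> nc; apply: jzeroMr.
have r0 := rho_gt0 y.
have ri : 0 < (rho y)^-1 by rewrite invr_gt0.
move: nc; rewrite negb_or -!ltNge => /andP[x2 xl].
have h1 : 1 <= 1 * x + 0 * y + - (1/4) by lra.
have h2 : 1 <= -1 * x + 0 * y + (l - 2) by lra.
have [a0 a1 a2] := smoothstep_ge1 h1; have [b0 b1 b2] := smoothstep_ge1 h2.
split; rewrite /= /cst -/l ?a0 ?a1 ?a2 ?b0 ?b1 ?b2; ring.
Qed.

Lemma jneumann_above : 1 <= y -> jzero (x, y) (jneumann eps).
Proof.
move=> y1; apply: jzeroMl; apply: jzeroMr.
have h1 : 1 <= 0 * x + 1 * y + 0 by lra.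
have [a0 a1 a2] := smoothstep_ge1 h1.
by split; rewrite /= /cst ?a0 ?a1 ?a2; ring.
Qed.

(** A bound on the corrector at scale 1; it serves at scale [rho y] because
    [1/2 <= rho y] where the corrector does not vanish. *)
Definition Cneumann : R := 4 * (4 * (1 * (1 + 4 * 120)) * (1 + 4 * (4 * (120 * 120)))).

Lemma scaled_neumann1 : y <= 1 -> scaled Cneumann 1 (jneumann eps) (x, y).
Proof.
move=> y1; have y0 : 0 <= y by case/andP: y0Y.
have t1 : 0 <= (1 : R) <= 1 by rewrite ler01 lexx.
have one : scaled 1 1 (jcst 1) (x, y) by have := scaled_cst (x, y) t1 1; rewrite normr1.
have S1 a b c : `|a| <= 1 -> `|b| <= 1 -> scaled 120 1 (jS (jaff a b c)) (x, y).
  move=> a1 b1; have [s0 s1 s2] := smoothstep_bound (j0 (jaff a b c) (x, y)).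
  rewrite (_ : 120 = 120 * 1 ^+ 2); last by ring.
  apply: scaled_comp => //; split; rewrite /= /cst ?normr0 ?mul1r ?expr1n//.
have n0 : `|0 : R| <= 1 by rewrite normr0.
have n1 : `|1 : R| <= 1 by rewrite normr1.
have nN1 : `|-1 : R| <= 1 by rewrite normrN1.
rewrite /Cneumann; apply: scaled_mul => //.
- apply: scaled_mul => //.
  + split; [|split]; rewrite /= /cst ?normr0 ?normr1 ?mul1r ?expr1n//.
    by rewrite mul0r add0r addr0 ger0_norm.
  + by apply: scaled_add => //; apply: scaled_neg => //; apply: S1.
- by apply: scaled_add => //; apply: scaled_neg => //; apply: scaled_mul => //; apply: S1.
Qed.

Lemma rho_ge_half : 0 <= y <= 1 -> 1/2 <= rho y.
Proof.
move=> /andP[y0 y1]; have r0 := rho_gt0 y; have r1 := rho_le1 y.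
have y21 : y ^+ 2 <= 1 by rewrite exprn_ile1.
have r4 : 0 <= rho y ^+ 4 by rewrite exprn_ge0// ltW.
have h : rho y ^+ 4 * (1 + y ^+ 2) <= rho y ^+ 4 * 2 by rewrite ler_wpM2l//; lra.
rewrite rho4 in h.
have : rho y ^+ 4 <= rho y by rewrite exprS ler_piMr ?exprn_ile1 ?(ltW r0).
lra.
Qed.

Lemma scaled_neumann : scaled (4 * Cneumann) scale (jneumann eps) (x, y).
Proof.
have CB0 : 0 <= Cneumann by rewrite /Cneumann; lra.
have CB4 : 0 <= 4 * Cneumann by lra.
have zB : jzero (x, y) (jneumann eps) ->
    scaled (4 * Cneumann) scale (jneumann eps) (x, y).
  by move=> /(jzero_scaled scale); exact: scaled_le.
(* the corrector vanishes off the core and for [1 <= y] *)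
have [c|/jneumann_off_core//] := boolP core.
have [y1|/ltW/jneumann_above//] := leP y 1.
have [h0 [h1 h2 h3 h4]] := scaled_neumann1 y1.
have y0 : 0 <= y by case/andP: y0Y.
have rh : 1/2 <= rho y by apply: rho_ge_half; rewrite y0.
have hs : scale = rho y by rewrite /scale c.
have rh2 : 1/4 <= rho y ^+ 2.
  have : 1/2 * (1/2) <= rho y * rho y by apply: ler_pM; lra.
  by rewrite expr2; lra.
have q1 : Cneumann <= 4 * Cneumann * rho y by rewrite -mulrA mulrCA ler_peMr//; lra.
have q2 : Cneumann <= 4 * Cneumann * rho y ^+ 2 by rewrite -mulrA mulrCA ler_peMr//; lra.
rewrite expr1n mulr1 in h1 h2 h3 h4.
split; [lra|split]; rewrite hs; lra.
Qed.

(** Bounds on [phi] and on the whole perturbation [Theta - y], independent of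
    [eps] and of the point. *)
Definition Cphi : R := 4 * (`|pi| * 1080).
Definition Cpert : R := Cphi + 4 * (1920 * (pi + 4 + 4 * Cphi)) + 4 * (4 * Cneumann).

Lemma scaled_pert : scaled Cpert scale (jpert eps) (x, y).
Proof.
have gphi : scaled Cphi scale (jphi eps) (x, y).
  by apply: scaled_mul => //; [exact: scaled_cst|exact: scaled_step].
apply: scaled_add; last by apply: scaled_neg => //; exact: scaled_neumann.
apply: scaled_add => //; apply: scaled_mul => //; first exact: scaled_tau.
by apply: scaled_add; [exact: scaled_linear|exact: scaled_neg].
Qed.

End bounds.

End CompetitorBounds.

(** * Admissibility and energy density of the competitor *)

Section Admissibility.
Variable R : realType.

(** Functions that agree above height [Y] have the same derivatives there, as the
    half-plane above [Y] is open. *)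
Lemma jet_eq_above (J K : jet R) (Y : R) : jetP J -> jetP K ->
  (forall x y, Y < y -> j0 J (x, y) = j0 K (x, y)) -> forall x y, Y < y ->
  [/\ jx J (x, y) = jx K (x, y), jy J (x, y) = jy K (x, y),
      jxx J (x, y) = jxx K (x, y), jxy J (x, y) = jxy K (x, y) &
      jyy J (x, y) = jyy K (x, y)].
Proof.
move=> pJ pK JK.
have step v (f g df dg : R * R -> R) : (forall x y, Y < y -> f (x, y) = g (x, y)) ->
    (forall z, is_derive z v f (df z)) -> (forall z, is_derive z v g (dg z)) ->
    forall x y, Y < y -> df (x, y) = dg (x, y).
  move=> fg Df Dg x y yY; apply: (@is_derive_eq_near _ f g (x, y) v) => //.
  by apply: filterS (near_y x yY) => -[a b] /=; exact: fg.
have ex := step _ _ _ _ _ JK (jdx pJ) (jdx pK).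
have ey := step _ _ _ _ _ JK (jdy pJ) (jdy pK).
have exx := step _ _ _ _ _ ex (jdxx pJ) (jdxx pK).
have exy := step _ _ _ _ _ ex (jdxy pJ) (jdxy pK).
have eyy := step _ _ _ _ _ ey (jdyy pJ) (jdyy pK).
by move=> x y yY; split; auto.
Qed.

Section competitor.
Variable eps : R.
Hypothesis eps01 : 0 < eps <= 1.
Let l := period eps.
Let Y := 1 / eps ^+ 2.
Let theta := jphase eps.

Let thetaP : jetP theta. Proof. exact: jphaseP. Qed.

Lemma admissible_phase : admissible eps (1 - 2 / l) 0 (j0 theta).
Proof.
have l2 : 2 <= l := period_ge2 eps01; have pT := thetaP.
have al : (1 - 2 / l) * l = l - 2 by rewrite mulrBl mul1r divfK// gt_eqF//; lra.
have wper x y : j0 theta (x + l, y) = j0 theta (x, y) + pi by exact: j0_phase_shift.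
have el : eps * l = pi := eps_period eps01.
split.
- exists (fun x => j0 theta (x, 0)).
    by apply: (trace_continuous (jc0 pT) (jcx pT) (jcy pT)); [exact: jdx|exact: jdy].
  apply: aeW => x; rewrite -/l al => /andP[x0 xl].
  by apply: phase_bottom => //; rewrite x0 ltW.
- exists (jy theta), (fun x => jy theta (x, 0)); split.
  + by apply: weak_diry; [exact: jc0|exact: jcy|exact: jdy].
  + by apply: (trace_continuous (jcy pT) (jcxy pT) (jcyy pT)); [exact: jdyx|exact: jdyy].
  + by apply: aeW => x; rewrite -/l al => h; exact: phase_y_bottom.
- move=> x y y0.
  change (j0 theta (x + l, y) - eps * (x + l) = j0 theta (x, y) - eps * x).
  rewrite wper -el; ring.
- pose W := jadd theta (jaff (- eps) (- slope eps) 0).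
  have pW : jetP W by apply: jaddP => //; exact: jaffP.
  have -> : (fun z => j0 theta z -
      (eps * z.1 + Num.sqrt (1 - eps ^+ 2) * z.2 + 0)) = j0 W.
    by apply/funext => z; rewrite /= /slope; ring.
  (* the remainder vanishes identically above height [Y] *)
  have W0 x y : Y < y -> j0 W (x, y) = 0.
    move=> /ltW yY.
    change (j0 theta (x, y) + (- eps * x + - slope eps * y + 0) = 0).
    rewrite phase_linear//; ring.
  have W0' := jet_eq_above (Y := Y) pW (jaffP 0 0 0) _.
  have {}W0' x y : Y < y -> [/\ jx W (x, y) = 0, jy W (x, y) = 0, jxx W (x, y) = 0,
     jxy W (x, y) = 0 & jyy W (x, y) = 0].
    by apply: W0' => a b h; rewrite W0// /= !mul0r !addr0.
  split.
    move=> x y y0.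
    change (j0 theta (x + l, y) + (- eps * (x + l) + - slope eps * y + 0) =
      j0 theta (x, y) + (- eps * x + - slope eps * y + 0)).
    rewrite wper -el; ring.
  exists (jx W), (jy W), (jxx W), (jxy W), (jyy W); split.
    split.
    + exact: weak_dirx (jc0 pW) (jcx pW) (jdx pW).
    + exact: weak_diry (jc0 pW) (jcy pW) (jdy pW).
    + exact: weak_dirx (jcx pW) (jcxx pW) (jdxx pW).
    + exact: weak_diry (jcx pW) (jcxy pW) (jdxy pW).
    + exact: weak_diry (jcy pW) (jcyy pW) (jdyy pW).
  split; last split.
  + exact: L2cyl_continuous (jc0 pW) W0.
  + have W0x x y : Y < y -> jx W (x, y) = 0 by case/(W0' x).
    exact: L2cyl_continuous (jcx pW) W0x.
  + have W0y x y : Y < y -> jy W (x, y) = 0 by case/(W0' x).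
    exact: L2cyl_continuous (jcy pW) W0y.
  + have W0xx x y : Y < y -> jxx W (x, y) = 0 by case/(W0' x).
    exact: L2cyl_continuous (jcxx pW) W0xx.
  + have W0xy x y : Y < y -> jxy W (x, y) = 0 by case/(W0' x).
    exact: L2cyl_continuous (jcxy pW) W0xy.
  + have W0yy x y : Y < y -> jyy W (x, y) = 0 by case/(W0' x).
    exact: L2cyl_continuous (jcyy pW) W0yy.
Qed.

(** The energy density of the competitor. *)
Definition dens (z : R * R) : R := (jxx theta z + jyy theta z) ^+ 2 +
  (1 - (jx theta z ^+ 2 + jy theta z ^+ 2)) ^+ 2.

Lemma dens_ge0 z : 0 <= dens z.
Proof. by rewrite addr_ge0 ?sqr_ge0. Qed.

Lemma continuous_dens : continuous dens.
Proof.
have pT := thetaP.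
have c2 f := @continuous_exprnR R (R * R)%type f 2.
have E : dens = fun z => (jxx theta z + jyy theta z) ^+ 2 +
  (1 + (- 1) * (jx theta z ^+ 2 + jy theta z ^+ 2)) ^+ 2.
  by apply/funext => z; rewrite mulN1r.
rewrite E; apply: continuous_addR; apply: (c2 _).
  by apply: continuous_addR; [exact: jcxx|exact: jcyy].
apply: continuous_addR; first exact: continuous_cstR.
apply: continuous_mulR; first exact: continuous_cstR.
by apply: continuous_addR; apply: (c2 _); [exact: jcx|exact: jcy].
Qed.

Lemma dens_above x y : Y < y -> dens (x, y) = 0.
Proof.
move=> yY; have H a b : Y < b -> j0 theta (a, b) = j0 (jaff eps (slope eps) 0) (a, b).
  by move=> /ltW h; rewrite phase_linear// /= addr0.
have [ex ey exx _ eyy] := jet_eq_above thetaP (jaffP eps (slope eps) 0) H x yY.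
rewrite /dens ex ey exx eyy /= /cst.
have s2 : slope eps ^+ 2 = 1 - eps ^+ 2.
  case/andP: eps01 => e0 e1; rewrite sqr_sqrtr// subr_ge0.
  by rewrite exprn_ile1// ltW.
rewrite s2; ring.
Qed.

(** The constant of [density_bound] for the competitor. *)
Definition Kdens : R := (2 * Cpert R) ^+ 2 + (2 * Cpert R + 2 * Cpert R ^+ 2) ^+ 2.

Lemma dens_bound x y : 0 <= x < l -> 0 <= y <= Y ->
  dens (x, y) <= Kdens * scale eps x y ^+ 4.
Proof.
move=> hx hy.
have /andP[t0 t1] := scale01 eps01 x y.
have t01 : 0 <= scale eps x y <= 1 by rewrite ltW.
have := density_bound t01 (scaled_pert eps01 hx hy).
have pc f : pext l 0 f (x, y) = f (x, y) by exact: pext_cell0.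
rewrite /dens /theta /jphase; cbn [jx jy jxx jyy jext].
rewrite !pc /jcell; cbn [jx jy jxx jyy jadd jaff].
by rewrite /cst !add0r.
Qed.

End competitor.

End Admissibility.

(** * The energy of the competitor *)

Section Energy.
Variable R : realType.

Lemma integral_steps (a b u1 v1 u2 v2 u3 v3 : R) : 0 <= a -> 0 <= b ->
  u1 <= v1 -> u2 <= v2 -> u3 <= v3 ->
  (\int[lebesgue_measure]_x (a * \1_(`[u1, v1]%classic) x +
      (b * \1_(`[u2, v2]%classic) x + b * \1_(`[u3, v3]%classic) x))%:E =
   (a * (v1 - u1) + (b * (v2 - u2) + b * (v3 - u3)))%:E)%E.
Proof.
move=> a0 b0 h1 h2 h3.
have mI (u v : R) : measurable_fun setT (EFin \o (\1_(`[u, v]%classic) : R -> R)).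
  by apply/measurable_EFinP; exact: measurable_indic.
have mcI (c u v : R) : measurable_fun setT (fun x => (c * \1_(`[u, v]%classic) x)%:E).
  by apply/measurable_EFinP; apply: measurable_funM => //; exact: measurable_indic.
have ge (c u v x : R) : 0 <= c -> (0 <= (c * \1_(`[u, v]%classic) x)%:E)%E.
  by move=> c0; rewrite lee_fin mulr_ge0.
have I (c u v : R) : 0 <= c -> u <= v ->
  (\int[lebesgue_measure]_x (c * \1_(`[u, v]%classic) x)%:E = (c * (v - u))%:E)%E.
  move=> c0 uv.
  under eq_integral do rewrite EFinM.
  rewrite ge0_integralZl_EFin//; last exact: mI.
  rewrite integral_indic//= setIT lebesgue_measure_itv /= lte_fin.
  move: uv; rewrite le_eqVlt => /predU1P[->|uv].
    by rewrite ltxx mule0 subrr mulr0.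
  by rewrite uv -EFinD -EFinM.
under eq_integral do rewrite EFinD EFinD.
rewrite ge0_integralD//; last 4 first.
- by move=> x _; exact: ge.
- exact: mcI.
- by move=> x _; apply: adde_ge0; exact: ge.
- by apply: emeasurable_funD; exact: mcI.
rewrite ge0_integralD//; last 4 first.
- by move=> x _; exact: ge.
- exact: mcI.
- by move=> x _; exact: ge.
- exact: mcI.
by rewrite !I.
Qed.

Section competitor.
Variable eps : R.
Hypothesis eps01 : 0 < eps <= 1.
Let l := period eps.
Let Y := 1 / eps ^+ 2.

Let f : R * R -> \bar R := (fun z => (dens eps z)%:E) \_ (cyl eps).

(** The density is at most a multiple of [eps ^+ 4] over the whole period plus
    a multiple of [rho y ^+ 4] over two intervals of total length
    [5 + (rho y)^-1]. *)
Lemma dens_section_le y : 0 <= y <= Y ->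
  (\int[lebesgue_measure]_x f (x, y) <=
   (Kdens R * (8 * pi + 6) * rho y ^+ 3)%:E)%E.
Proof.
move=> hy.
have e0 := eps_gt0 eps01; have r0 := rho_gt0 y; have r1 := rho_le1 y.
have K0 : 0 <= Kdens R by rewrite /Kdens addr_ge0 ?sqr_ge0.
have l2 : 2 <= l := period_ge2 eps01.
have ri : 0 < (rho y)^-1 by rewrite invr_gt0.
have er := eps_le_rho eps01 hy.
have e4 : 0 <= Kdens R * eps ^+ 4 by rewrite mulr_ge0// exprn_ge0// ltW.
have r4 : 0 <= Kdens R * rho y ^+ 4 by rewrite mulr_ge0// exprn_ge0// ltW.
have mf : measurable_fun setT f.
  have := (measurable_restrictT (EFin \o dens eps) (measurable_cyl eps)).1.
  apply; apply/measurable_EFinP; apply: continuous_measurable_prod.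
    exact: measurable_cyl.
  exact: continuous_dens.
apply: (@le_trans _ _ (\int[lebesgue_measure]_x
   ((Kdens R * eps ^+ 4) * \1_(`[0, l]%classic) x +
    ((Kdens R * rho y ^+ 4) * \1_(`[0, 2]%classic) x +
     (Kdens R * rho y ^+ 4) * \1_(`[l - 3 - (rho y)^-1, l]%classic) x))%:E)%E).
  apply: ge0_le_integral => //.
  - move=> x _; rewrite /f patchE; case: ifP => // _.
    by rewrite lee_fin; exact: dens_ge0.
  - exact: (measurableT_comp mf (measurable_pair2 y)).
  - apply/measurable_EFinP; apply: measurable_funD; last apply: measurable_funD;
      by apply: measurable_funM => //; exact: measurable_indic.
  - move=> x _; rewrite /f patchE; case: ifPn => [|_]; last first.
      by rewrite lee_fin !addr_ge0// mulr_ge0.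
    rewrite inE => -[/=]; rewrite !in_itv /= => /andP[x0 xl] _.
    have hx : 0 <= x < l by rewrite x0.
    rewrite lee_fin; apply: le_trans (dens_bound eps01 hx hy) _.
    rewrite !indicE !mem_setE !in_itv /= x0 (ltW xl) /= ?andbT ?mulr1.
    rewrite /scale /core -/l.
    by have [x2|x2] := leP x 2; have [xx|xx] := leP (l - 3 - (rho y)^-1) x;
      rewrite /= ?mulr1n ?mulr0n ?mulr1 ?mulr0; lra.
rewrite integral_steps//; [|lra..].
rewrite lee_fin.
have e3 : eps ^+ 3 <= 8 * rho y ^+ 3.
  rewrite (_ : 8 * _ = (2 * rho y) ^+ 3); last by ring.
  by rewrite lerXn2r// nnegrE; lra.
have p3 : pi * eps ^+ 3 <= pi * (8 * rho y ^+ 3) by rewrite ler_wpM2l// pi_ge0.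
have q4 : rho y ^+ 4 <= rho y ^+ 3 by rewrite exprS ler_piMl// exprn_ge0// ltW.
have el : eps ^+ 4 * l = pi * eps ^+ 3 by rewrite -(eps_period eps01) -/l; ring.
have rr : rho y ^+ 4 * (rho y)^-1 = rho y ^+ 3.
  by rewrite exprS mulrAC mulfV ?mul1r// gt_eqF.
rewrite (_ : _ + _ = Kdens R *
  (eps ^+ 4 * l + 5 * rho y ^+ 4 + rho y ^+ 4 * (rho y)^-1)); last by ring.
rewrite el rr -mulrA ler_wpM2l//; lra.
Qed.

Lemma integral_dens_le : (\int[@mu2 R]_(z in cyl eps) (dens eps z)%:E <=
  (Kdens R * (8 * pi + 6) * 8)%:E)%E.
Proof.
have K0 : 0 <= Kdens R by rewrite /Kdens addr_ge0 ?sqr_ge0.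
have p0 := pi_ge0 R.
have C0 : 0 <= Kdens R * (8 * pi + 6) by rewrite mulr_ge0//; lra.
have mf : measurable_fun setT f.
  have := (measurable_restrictT (EFin \o dens eps) (measurable_cyl eps)).1.
  apply; apply/measurable_EFinP; apply: continuous_measurable_prod.
    exact: measurable_cyl.
  exact: continuous_dens.
have f0 z : (0 <= f z)%E.
  by rewrite /f patchE; case: ifP => // _; rewrite lee_fin; exact: dens_ge0.
rewrite integral_mkcond -/f fubini_tonelli2//.
apply: (@le_trans _ _ (\int[lebesgue_measure]_(y in `[0%R, Y])
   (Kdens R * (8 * pi + 6) * rho y ^+ 3)%:E)%E).
  rewrite [leRHS]integral_mkcond; apply: ge0_le_integral => //.
  - by move=> y _; apply: integral_ge0.
  - exact: measurable_fun_fubini_tonelli_G.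
  - apply: (measurable_restrictT _ _).1 => //.
    apply/measurable_EFinP; apply: measurable_funM => //.
    apply: measurable_funTS; apply: continuous_measurable_fun.
    by apply: continuous_exprnR; exact: continuous_rho.
  - move=> y _; rewrite patchE; case: ifPn => [|].
      by rewrite inE /= in_itv /= => hy; exact: dens_section_le.
    rewrite notin_setE /= in_itv /= => hy.
    rewrite /fubini_G integral0_eq// => x _; rewrite /f patchE; case: ifPn => //.
    rewrite inE => -[_ /=]; rewrite in_itv /= andbT => y0.
    rewrite dens_above// ltNge; apply/negP => yY; apply: hy; rewrite y0; exact: yY.
under eq_integral do rewrite EFinM.
have Y0 : 0 < Y by rewrite divr_gt0// exprn_gt0// eps_gt0.
rewrite ge0_integralZl_EFin//; last 2 first.
- by move=> y _; rewrite lee_fin exprn_ge0// ltW// rho_gt0.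
- apply/measurable_EFinP; apply: measurable_funTS; apply: continuous_measurable_fun.
  by apply: continuous_exprnR; exact: continuous_rho.
rewrite [leRHS]EFinM; apply: lee_wpmul2l; first by rewrite lee_fin.
by apply: integral_rho3.
Qed.

End competitor.

End Energy.

Theorem theorem2p1 (R : realType) :
  exists E0 : R, forall eps : R, 0 < eps <= 1 ->
    forall (theta : R * R -> R) (a delta : R),
      minimizer eps theta a delta -> (energy eps theta <= E0%:E)%E.
Proof.
exists (Kdens R * (8 * pi + 6) * 8) => eps eps01 theta a delta [_ _ min].
have pT := jphaseP eps01.
have l2 := period_ge2 eps01.
have a01 : 0 <= 1 - 2 / period eps <= 1.
  have i0 : 0 < 2 / period eps by rewrite divr_gt0//; lra.
  have i1 : 2 / period eps <= 1 by rewrite ler_pdivrMr ?mul1r//; lra.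
  by apply/andP; split; lra.
apply: le_trans (min _ _ _ a01 (admissible_phase eps01)) _.
apply: le_trans (integral_dens_le eps01).
apply: ereal_inf_lbound.
exists (jx (jphase eps)), (jy (jphase eps)), (jxx (jphase eps)), (jyy (jphase eps)).
split => //.
- exact: weak_dirx (jc0 pT) (jcx pT) (jdx pT).
- exact: weak_diry (jc0 pT) (jcy pT) (jdy pT).
- exact: weak_dirx (jcx pT) (jcxx pT) (jdxx pT).
- exact: weak_diry (jcy pT) (jcyy pT) (jdyy pT).
Qed.
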